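(* Let $\Gamma=\Gamma_\rho(\zeta)$ be the spherical cap with center $\zeta\in\Omega$ and radius $\rho\in(0,2)$. For $\xi\in\Gamma_\rho(\zeta)$ set $$\check{r}=-\frac{1+2(\xi\cdot\zeta)(\rho-1)+(\rho-1)^2}{\rho(\rho-2)},\qquad \check{\xi}=\frac{1}{\check{r}}\,\xi-\frac{\check{r}-1}{\check{r}(\rho-1)}\,\zeta,$$ where for $\rho=1$ the quotient $\frac{\check r-1}{\rho-1}$ is understood as its continuous extension $2\,\xi\cdot\zeta$. Then $$G_D(\Delta^*;\xi,\eta)=\frac{1}{4\pi}\ln(1-\xi\cdot\eta)-\frac{1}{4\pi}\ln\big(\check{r}(1-\check{\xi}\cdot\eta)\big)$$ is the Dirichlet Green function for $\Gamma_\rho(\zeta)$ with respect to the Beltrami operator. Moreover, if $F\in C^{(0)}(\partial\Gamma_\rho(\zeta))$ and $U\in C^{(2)}(\overline{\Gamma_\rho(\zeta)})$ is a solution of the Dirichlet problem $\Delta^*U=0$ in $\Gamma_\rho(\zeta)$, $U=F$ on $\partial\Gamma_\rho(\zeta)$, then $$U(\xi)=\frac{1}{2\pi}\frac{\xi\cdot\zeta+\rho-1}{\sqrt{\rho(2-\rho)}}\int_{\partial\Gamma_\rho(\zeta)}\frac{1}{1-\xi\cdot\eta}F(\eta)\,d\sigma(\eta),\qquad \xi\in\Gamma_\rho(\zeta).$$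
   Context: $\Omega=\{x\in\mathbb{R}^3:|x|=1\}$ is the unit sphere, $\Delta^*$ the Beltrami operator (Laplace–Beltrami operator) on $\Omega$, $d\sigma$ the line element on boundary curves. The spherical cap with center $\zeta\in\Omega$ and radius $\rho\in(0,2)$ is $\Gamma_\rho(\zeta)=\{\eta\in\Omega:1-\zeta\cdot\eta<\rho\}$. The fundamental solution for the Beltrami operator is $$G(\Delta^*;t)=\frac{1}{4\pi}\ln(1-t)+\frac{1}{4\pi}(1-\ln 2),\quad t\in[-1,1).$$ For a region $\Gamma\subset\Omega$ with smooth boundary, a function $G_D(\Delta^*;\cdot,\cdot)$ is called a Dirichlet Green function (with respect to the Beltrami operator) if $$G_D(\Delta^*;\xi,\eta)=G(\Delta^*;\xi\cdot\eta)-\Phi_D(\xi,\eta),\quad \eta\in\overline{\Gamma},\ \xi\in\Gamma,\ \xi\neq\eta,$$ where, for every $\xi\in\Gamma$, $\Phi_D(\xi,\cdot)\in C^{(2)}(\Gamma)\cap C^{(1)}(\overline{\Gamma})$ satisfies $\Delta^*_\eta\Phi_D(\xi,\eta)=-\frac{1}{4\pi}$ for $\eta\in\Gamma$ and $\Phi_D(\xi,\eta)=G(\Delta^*;\xi\cdot\eta)$ for $\eta\in\partial\Gamma$ (boundary values taken from within $\Gamma$). *)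

(* Defs.v *)
From Stdlib Require Import Reals.
From Coquelicot Require Import Coquelicot.
Open Scope R_scope.

Notation R3 := (R * R * R)%type.

Inductive axis : Set := ax1 | ax2 | ax3.

Definition coord (a : axis) (x : R3) : R :=
  match a with ax1 => fst (fst x) | ax2 => snd (fst x) | ax3 => snd x end.

(** [upd a x t] is [x] with its [a]-th coordinate replaced by [t]. *)
Definition upd (a : axis) (x : R3) (t : R) : R3 :=
  match a with
  | ax1 => (t, snd (fst x), snd x)
  | ax2 => (fst (fst x), t, snd x)
  | ax3 => (fst (fst x), snd (fst x), t)
  end.

Definition dot (x y : R3) : R :=
  coord ax1 x * coord ax1 y + coord ax2 x * coord ax2 y + coord ax3 x * coord ax3 y.

Definition enorm (x : R3) : R := sqrt (dot x x).

Definition Omega (x : R3) : Prop := enorm x = 1.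

Definition closure (A : R3 -> Prop) (x : R3) : Prop :=
  forall eps : posreal, exists y : R3, ball x eps y /\ A y.

(** Boundary relative to the sphere; closures are the same in [R^3] and in
    [Omega], as [Omega] is closed. *)
Definition sphere_boundary (Gam : R3 -> Prop) (x : R3) : Prop :=
  closure Gam x /\ closure (fun y => Omega y /\ ~ Gam y) x.

(** * Calculus on the sphere

    A function on a subset of [Omega] is a total function on [R^3] of which only
    the values on that subset are used.  It is differentiated through its
    extension to the cone over the subset that is constant along rays. *)

Definition unit_of (x : R3) : R3 := scal (/ enorm x) x.

Definition radial_ext (f : R3 -> R) (x : R3) : R := f (unit_of x).

Definition cone (A : R3 -> Prop) (x : R3) : Prop :=
  x <> (0, 0, 0) /\ A (unit_of x).

(** For [D] open in [R^3] and [E] between [D] and its closure: [f] is continuous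
    on [E], and its partial derivatives up to order [k] exist in [D] and have
    continuous extensions to [E] ([g] is such an extension).  For [E = D] this is
    [C^k(D)]. *)
Fixpoint Ck (k : nat) (D E : R3 -> Prop) (f : R3 -> R) : Prop :=
  continuous_on E f /\
  match k with
  | O => True
  | S k' => forall a : axis, exists g : R3 -> R,
      (forall x, D x -> is_derive (fun t => f (upd a x t)) (coord a x) (g x)) /\
      Ck k' D E g
  end.

(** [C^(k)(Gam)] and [C^(k)] of the closure of [Gam], for [Gam] relatively open
    in [Omega]. *)
Definition Ck_open (k : nat) (Gam : R3 -> Prop) (f : R3 -> R) : Prop :=
  Ck k (cone Gam) (cone Gam) (radial_ext f).

Definition Ck_closure (k : nat) (Gam : R3 -> Prop) (f : R3 -> R) : Prop :=
  Ck k (cone Gam) (cone (closure Gam)) (radial_ext f).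

Definition partial (a : axis) (f : R3 -> R) (x : R3) : R :=
  Derive (fun t => f (upd a x t)) (coord a x).

Definition laplacian (f : R3 -> R) (x : R3) : R :=
  partial ax1 (partial ax1 f) x + partial ax2 (partial ax2 f) x
  + partial ax3 (partial ax3 f) x.

(** The Beltrami operator is the angular part of the Laplacian,
    [Delta = (d/dr)^2 + (2/r) (d/dr) + r^-2 Delta^*]; the radial terms vanish on
    functions that are constant along rays, and [r = 1] on [Omega]. *)
Definition beltrami (f : R3 -> R) (xi : R3) : R := laplacian (radial_ext f) xi.

(** [I] is the integral of [g] with respect to arc length over the simple closed
    curve [C], computed in a regular [C^1] parametrization [gam], with velocity
    [gam'], of [C] on [[a,b]]. *)
Definition is_line_integral (C : R3 -> Prop) (g : R3 -> R) (I : R) : Prop :=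
  exists (a b : R) (gam gam' : R -> R3),
    a < b /\
    (forall t, a <= t <= b ->
       is_derive gam t (gam' t) /\ continuous gam' t /\ gam' t <> (0, 0, 0)) /\
    gam a = gam b /\
    (forall s t, a <= s < b -> a <= t < b -> gam s = gam t -> s = t) /\
    (forall x, C x <-> exists t, a <= t <= b /\ gam t = x) /\
    is_RInt (fun t => g (gam t) * enorm (gam' t)) a b I.

(** * Green functions *)

Definition G_beltrami (t : R) : R :=
  / (4 * PI) * ln (1 - t) + / (4 * PI) * (1 - ln 2).

Definition is_dirichlet_green (Gam : R3 -> Prop) (GD : R3 -> R3 -> R) : Prop :=
  exists Phi : R3 -> R3 -> R,
    (forall xi eta, Gam xi -> closure Gam eta -> xi <> eta ->
       GD xi eta = G_beltrami (dot xi eta) - Phi xi eta) /\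
    (forall xi, Gam xi ->
       Ck_open 2 Gam (Phi xi) /\
       Ck_closure 1 Gam (Phi xi) /\
       (forall eta, Gam eta -> beltrami (Phi xi) eta = - / (4 * PI)) /\
       (forall eta, sphere_boundary Gam eta ->
          Phi xi eta = G_beltrami (dot xi eta))).

(** A Green function is determined only off the diagonal, for the first argument
    in [Gam] and the second in its closure. *)
Definition is_the_dirichlet_green (Gam : R3 -> Prop) (GD : R3 -> R3 -> R) : Prop :=
  is_dirichlet_green Gam GD /\
  forall GD', is_dirichlet_green Gam GD' ->
    forall xi eta, Gam xi -> closure Gam eta -> xi <> eta ->
      GD' xi eta = GD xi eta.

(** * Spherical caps *)

Definition cap (rho : R) (zeta eta : R3) : Prop :=
  Omega eta /\ 1 - dot zeta eta < rho.

Definition r_check (rho : R) (zeta xi : R3) : R :=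
  - ((1 + 2 * dot xi zeta * (rho - 1) + (rho - 1) ^ 2) / (rho * (rho - 2))).

(** [(r_check - 1) / (rho - 1)], extended continuously to [rho = 1]. *)
Definition r_check_quot (rho : R) (zeta xi : R3) : R :=
  if Req_EM_T rho 1 then 2 * dot xi zeta
  else (r_check rho zeta xi - 1) / (rho - 1).

Definition xi_check (rho : R) (zeta xi : R3) : R3 :=
  minus (scal (/ r_check rho zeta xi) xi)
        (scal (r_check_quot rho zeta xi / r_check rho zeta xi) zeta).

Definition cap_green (rho : R) (zeta xi eta : R3) : R :=
  / (4 * PI) * ln (1 - dot xi eta)
  - / (4 * PI) * ln (r_check rho zeta xi * (1 - dot (xi_check rho zeta xi) eta)).

(* Main.v *)
Require Import Defs.
From Stdlib Require Import Reals Lra Psatz Nsatz.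
From Coquelicot Require Import Coquelicot.
Open Scope R_scope.

(** The point [r_check * xi_check] is [Q = xi - q zeta] with [q = 2 (xi.zeta + rho - 1) / (rho (2 - rho))],
    and [|Q| = r_check]; so the regular part of the Green function is a logarithmic potential
    [ln (|Q| - Q.eta)] whose pole lies outside the closed cap, and it agrees with [ln (1 - xi.eta)]
    where [zeta.eta = 1 - rho].

    The Poisson formula comes from conformal polar coordinates [(s, t)] of the cap centered at [xi]:
    the null vector [k e^-s (1, xi) + k e^s (|Q|, Q) + cos t e1 + sin t e2] of Minkowski space, with
    [e1, e2] orthonormal and orthogonal to the first two vectors, projects to a point of the sphere which
    tends to [xi] as [s] tends to [-oo] and runs through the boundary circle for [s = 0].  A harmonic function [U] of
    the cap becomes harmonic in [(s, t)], so its mean over [t] is affine in [s], hence constant as it is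
    bounded: [U xi] is the mean of [U] over [t] at [s = 0].  There the arc length is
    [(1 - xi.eta) sqrt (rho (2 - rho)) / (xi.zeta + rho - 1) dt], which gives the Poisson kernel.  Applied to the
    difference of two regular parts, the same formula gives the uniqueness of the Green function. *)

(** * Calculus in three variables *)

(** The vector [(r_check, Q)] is the image of [(1, xi)] under the Minkowski reflection in the
    hyperplane of all [(T, V)] with [zeta.V = (1 - rho) T]. Its normal [(1 - rho, zeta)] has square
    [rho (2 - rho)], which is where [q] comes from. A reflection keeps null vectors null, hence
    [|Q| = r_check], and fixes the hyperplane, hence the agreement on the boundary circle. In terms
    of [q] the case [rho = 1] is not exceptional. Functions are extended from the sphere with
    homogeneity degree 0, so a parametrization matters only up to a positive factor. The null vector
    can therefore be used without dividing by its time component; the resulting error terms in the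
    Laplacian are radial, and Euler's relations absorb them. The regular part of a competing Green
    function is controlled only up to first order at the boundary. The Poisson formula is therefore
    proved for functions that are [C^2] inside and continuous up to the circle, and the value at
    [s = 0] is reached as a limit. *)

Definition sum3 (f : axis -> R) : R := f ax1 + f ax2 + f ax3.

Lemma ball_coord (x y : R3) (e : R) :
  ball x e y <-> forall a, Rabs (coord a y - coord a x) < e.
Proof.
  destruct x as [[x1 x2] x3], y as [[y1 y2] y3].
  change (((Rabs (y1 - x1) < e /\ Rabs (y2 - x2) < e) /\ Rabs (y3 - x3) < e) <->
          forall a, Rabs (coord a (y1, y2, y3) - coord a (x1, x2, x3)) < e).
  split.
  - intros [[H1 H2] H3] []; assumption.
  - intros H; exact (conj (conj (H ax1) (H ax2)) (H ax3)).
Qed.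

Lemma continuous_coord (a : axis) (x : R3) : continuous (coord a) x.
Proof.
  intros P [e He]; exists e; intros y Hy; apply He.
  apply (proj1 (ball_coord x y e) Hy).
Qed.

Lemma continuous_of_coord {U : UniformSpace} (f : U -> R3) (x : U) :
  (forall a, continuous (fun u => coord a (f u)) x) -> continuous f x.
Proof.
  intros H P [e He].
  assert (K : forall a, locally x (fun u => Rabs (coord a (f u) - coord a (f x)) < e)).
  { intros a; apply (H a (fun r => Rabs (r - coord a (f x)) < e)).
    exists e; intros r Hr; exact Hr. }
  unfold filtermap.
  generalize (filter_and _ _ (K ax1) (filter_and _ _ (K ax2) (K ax3))).
  apply filter_imp; intros u (H1 & H2 & H3); apply He, ball_coord; intros []; assumption.
Qed.

Lemma norm_coord_le (a : axis) (x : R3) : Rabs (coord a x) <= norm x.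
Proof.
  destruct x as [[x1 x2] x3].
  change (norm (x1, x2, x3)) with (sqrt (sqrt (Rabs x1 ^ 2 + Rabs x2 ^ 2) ^ 2 + Rabs x3 ^ 2)).
  assert (H1 := Rabs_pos x1). assert (H2 := Rabs_pos x2). assert (H3 := Rabs_pos x3).
  destruct a; unfold coord, fst, snd; apply Rsqr_incr_0_var; try apply sqrt_pos;
    rewrite (Rsqr_sqrt (_ + Rabs x3 ^ 2)), <- Rsqr_pow2, Rsqr_sqrt; unfold Rsqr; nra.
Qed.

(** The increment is split along a path of three segments parallel to the axes; on each of them the
    mean value theorem produces a partial derivative at a point near [x]. *)
Lemma filterdiff_of_partials (f : R3 -> R) (g : axis -> R3 -> R) (x : R3) :
  locally x (fun y => forall a, is_derive (fun t => f (upd a y t)) (coord a y) (g a y)) ->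
  (forall a, continuous (g a) x) ->
  filterdiff f (locally x) (fun h => g ax1 x * coord ax1 h + g ax2 x * coord ax2 h + g ax3 x * coord ax3 h).
Proof.
  intros [d Hd] Hg; split.
  { split.
    - intros [[u1 u2] u3] [[v1 v2] v3]; unfold coord, fst, snd, plus; simpl; unfold plus; simpl; ring.
    - intros k [[u1 u2] u3]; unfold coord, fst, snd, scal; simpl; unfold scal; simpl; unfold mult; simpl; ring.
    - exists (Rabs (g ax1 x) + Rabs (g ax2 x) + Rabs (g ax3 x) + 1); split.
      + generalize (Rabs_pos (g ax1 x)) (Rabs_pos (g ax2 x)) (Rabs_pos (g ax3 x)); lra.
      + intros h.
        assert (K1 := norm_coord_le ax1 h). assert (K2 := norm_coord_le ax2 h).
        assert (K3 := norm_coord_le ax3 h).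
        change (Rabs (g ax1 x * coord ax1 h + g ax2 x * coord ax2 h + g ax3 x * coord ax3 h)
          <= (Rabs (g ax1 x) + Rabs (g ax2 x) + Rabs (g ax3 x) + 1) * norm h).
        eapply Rle_trans; [apply Rabs_triang|].
        eapply Rle_trans; [apply Rplus_le_compat_r, Rabs_triang|].
        rewrite !Rabs_mult.
        generalize (Rabs_pos (g ax1 x)) (Rabs_pos (g ax2 x)) (Rabs_pos (g ax3 x))
          (Rabs_pos (coord ax1 h)); nra. }
  intros x' Hx'.
  assert (E : x = x') by exact (@is_filter_lim_locally_unique R_AbsRing
    (prod_NormedModule _ (prod_NormedModule _ R_NormedModule R_NormedModule) R_NormedModule) x x' Hx').
  subst x'.
  intros e.
  (* Each of the three segments may contribute a third of the error. *)
  assert (K : forall a, locally x (fun y => Rabs (g a y - g a x) < e / 3)).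
  { intros a; apply (Hg a (fun r => Rabs (r - g a x) < e / 3)).
    assert (He : 0 < e / 3) by (generalize (cond_pos e); lra).
    exists (mkposreal _ He); intros r Hr; exact Hr. }
  generalize (filter_and _ _ (K ax1) (filter_and _ _ (K ax2) (K ax3))).
  intros [d' Hd'].
  assert (Hm : 0 < Rmin d d') by (apply Rmin_pos; apply cond_pos).
  exists (mkposreal _ Hm).
  cut (forall y : R3, ball x (Rmin d d') y -> Rabs (f y - f x -
    (g ax1 x * (coord ax1 y - coord ax1 x) + g ax2 x * (coord ax2 y - coord ax2 x)
     + g ax3 x * (coord ax3 y - coord ax3 x))) <= e * norm (minus y x)); [exact (fun H => H)|].
  intros y Hy.
  assert (Hb : forall z : R3, (forall a, Rabs (coord a z - coord a x) <= Rabs (coord a y - coord a x)) ->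
     ball x d z /\ ball x d' z).
  { intros z Hz; split; apply ball_coord; intros a;
      (eapply Rle_lt_trans; [apply Hz|]);
      (eapply Rlt_le_trans; [apply (proj1 (ball_coord _ _ _) Hy a)|]).
    apply Rmin_l. apply Rmin_r. }
  assert (MVT : forall a (z : R3) (p q : R),
    (forall t, Rmin p q <= t <= Rmax p q -> ball x d (upd a z t) /\ ball x d' (upd a z t)) ->
    exists c, Rabs (g a c - g a x) < e / 3 /\ f (upd a z q) - f (upd a z p) = g a c * (q - p)).
  { intros a z p q Ht.
    assert (Hder : forall t, Rmin p q <= t <= Rmax p q ->
       is_derive (fun t => f (upd a z t)) t (g a (upd a z t))).
    { intros t H. destruct (Ht t H) as [H1 _]. generalize (Hd _ H1 a).
      destruct z as [[z1 z2] z3]; destruct a; exact (fun h => h). }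
    destruct (MVT_gen (fun t => f (upd a z t)) p q (fun t => g a (upd a z t))) as (c & Hc & E).
    - intros t H; apply Hder; lra.
    - intros t H; apply derivable_continuous_pt. exists (g a (upd a z t)); apply is_derive_Reals, Hder, H.
    - exists (upd a z c); split; [|exact E].
      destruct (Ht c Hc) as [_ H]. destruct (Hd' _ H) as (H1 & H2 & H3).
      destruct a; assumption. }
  assert (mid : forall p q t, Rmin p q <= t <= Rmax p q -> Rabs (t - p) <= Rabs (q - p)).
  { intros p q t; unfold Rmin, Rmax; destruct (Rle_dec p q); intros H; unfold Rabs;
      repeat destruct Rcase_abs; lra. }
  destruct x as [[x1 x2] x3], y as [[y1 y2] y3].
  (* The path replaces the coordinates of [y] by those of [x] one at a time, so that in every
     coordinate it stays as close to [x] as [y] is. *)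
  destruct (MVT ax1 (x1, y2, y3) x1 y1) as (c1 & Hc1 & E1).
  { intros t Ht; apply Hb; intros []; simpl; try lra; apply mid, Ht. }
  destruct (MVT ax2 (x1, x2, y3) x2 y2) as (c2 & Hc2 & E2).
  { intros t Ht; apply Hb; intros []; simpl; try (apply mid, Ht); try lra.
    rewrite Rminus_diag, Rabs_R0; apply Rabs_pos. }
  destruct (MVT ax3 (x1, x2, x3) x3 y3) as (c3 & Hc3 & E3).
  { intros t Ht; apply Hb; intros []; simpl; try (apply mid, Ht); try lra;
    rewrite Rminus_diag, Rabs_R0; apply Rabs_pos. }
  simpl in E1, E2, E3.
  assert (N1 := norm_coord_le ax1 (minus (y1, y2, y3) (x1, x2, x3))).
  assert (N2 := norm_coord_le ax2 (minus (y1, y2, y3) (x1, x2, x3))).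
  assert (N3 := norm_coord_le ax3 (minus (y1, y2, y3) (x1, x2, x3))).
  set (N := norm _) in *.
  change (Rabs (y1 - x1) <= N) in N1. change (Rabs (y2 - x2) <= N) in N2.
  change (Rabs (y3 - x3) <= N) in N3.
  unfold coord, fst, snd.
  replace (f (y1, y2, y3) - f (x1, x2, x3)) with (g ax1 c1 * (y1 - x1) + g ax2 c2 * (y2 - x2) + g ax3 c3 * (y3 - x3))
    by (rewrite <- E1, <- E2, <- E3; ring).
  match goal with |- Rabs ?L <= _ => replace L with ((g ax1 c1 - g ax1 (x1, x2, x3)) * (y1 - x1)
    + (g ax2 c2 - g ax2 (x1, x2, x3)) * (y2 - x2) + (g ax3 c3 - g ax3 (x1, x2, x3)) * (y3 - x3)) by ring end.
  eapply Rle_trans; [apply Rabs_triang|].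
  eapply Rle_trans; [apply Rplus_le_compat_r, Rabs_triang|].
  rewrite !Rabs_mult.
  assert (P : forall u v, Rabs u < e / 3 -> Rabs v <= N -> Rabs u * Rabs v <= e / 3 * N).
  { intros u v Hu Hv; apply Rmult_le_compat; try apply Rabs_pos; lra. }
  generalize (P _ _ Hc1 N1) (P _ _ Hc2 N2) (P _ _ Hc3 N3); lra.
Qed.

Lemma is_derive_pair {V W : NormedModule R_AbsRing} (u : R -> V) (v : R -> W) (t : R) (du : V) (dv : W) :
  is_derive u t du -> is_derive v t dv -> is_derive (fun t => (u t, v t)) t (du, dv).
Proof.
  intros Hu Hv.
  apply (filterdiff_ext_lin _ (fun h : R => (scal h du, scal h dv))); [|reflexivity].
  refine (filterdiff_comp'_2 u v pair t _ _ (fun a b => (a, b)) Hu Hv _).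
  apply (filterdiff_ext_lin _ (fun p => p)); [|intros []; reflexivity].
  apply filterdiff_ext with (fun p : V * W => p); [intros []; reflexivity|].
  apply filterdiff_id.
Qed.

Lemma is_derive_of_coord (X : R -> R3) (t : R) (d : R3) :
  (forall a, is_derive (fun t => coord a (X t)) t (coord a d)) -> is_derive X t d.
Proof.
  intros H.
  apply is_derive_ext with (fun t => (coord ax1 (X t), coord ax2 (X t), coord ax3 (X t))).
  { intros s; destruct (X s) as [[? ?] ?]; reflexivity. }
  replace d with (coord ax1 d, coord ax2 d, coord ax3 d) by (destruct d as [[? ?] ?]; reflexivity).
  apply is_derive_pair; [apply is_derive_pair|]; apply H.
Qed.

Lemma chain_rule (f : R3 -> R) (g : axis -> R3 -> R) (X : R -> R3) (s : R) (d : axis -> R) :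
  locally (X s) (fun y => forall a, is_derive (fun t => f (upd a y t)) (coord a y) (g a y)) ->
  (forall a, continuous (g a) (X s)) ->
  (forall a, is_derive (fun t => coord a (X t)) s (d a)) ->
  is_derive (fun t => f (X t)) s
    (sum3 (fun a => g a (X s) * d a)).
Proof.
  intros Hf Hg HX.
  assert (H := is_derive_of_coord X s (d ax1, d ax2, d ax3)
    (fun a => match a with ax1 => HX ax1 | ax2 => HX ax2 | ax3 => HX ax3 end)).
  eapply filterdiff_ext_lin.
  - exact (filterdiff_comp' X f s _ _ H (filterdiff_of_partials f g (X s) Hf Hg)).
  - intros h; unfold sum3; simpl. unfold scal; simpl; unfold scal; simpl; unfold mult; simpl; ring.
Qed.

(** * Means over circles *)

Lemma continuous_of_2d (f : R -> R -> R) (r t : R) :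
  continuity_2d_pt f r t -> continuous (f r) t.
Proof.
  intros H; apply continuity_pt_filterlim, continuity_pt_locally; intros e.
  destruct (H e) as [d Hd]; exists d; intros y Hy.
  apply Hd; [rewrite Rminus_diag, Rabs_R0; apply cond_pos|exact Hy].
Qed.

Lemma continuous_RInt_param (u : R -> R -> R) (a b r : R) : a <= b ->
  (forall s t, continuity_2d_pt u s t) ->
  forall eps : posreal, exists d : posreal, forall s, Rabs (s - r) < d ->
    Rabs (RInt (u s) a b - RInt (u r) a b) <= (b - a) * eps.
Proof.
  intros Hab Hu eps.
  destruct (uniform_continuity_2d_1d' u a b r (fun x _ => Hu r x) eps) as [d Hd].
  exists d; intros s Hs.
  assert (Hi : forall s, ex_RInt (u s) a b).
  { intros s'; apply (@ex_RInt_continuous R_CompleteNormedModule); intros z _; apply continuous_of_2d, Hu. }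
  change (RInt (u s) a b - RInt (u r) a b) with (minus (RInt (u s) a b) (RInt (u r) a b)).
  rewrite <- (RInt_minus (V := R_CompleteNormedModule)) by apply Hi.
  apply abs_RInt_le_const; [exact Hab| |].
  - apply (ex_RInt_minus (V := R_NormedModule)); apply Hi.
  - intros t Ht. apply Rlt_le, Hd; try assumption.
    + generalize (cond_pos d); lra.
    + apply Rabs_def2 in Hs; lra.
    + rewrite Rminus_diag, Rabs_R0; apply cond_pos.
Qed.

(* In the coordinates [s + i t = ln z] the circular mean of a harmonic function is
   affine in [s], and boundedness near the center kills the slope. *)
Lemma circle_mean_eq_center (u ws wss wt : R -> R -> R) :
  (forall r t, continuity_2d_pt u r t) ->
  (forall s t, s < 0 ->
     is_derive (fun s => u (exp s) t) s (ws s t) /\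
     is_derive (fun s => ws s t) s (wss s t) /\
     is_derive (fun t => u (exp s) t) t (wt s t) /\
     is_derive (fun t => wt s t) t (- wss s t) /\
     continuity_2d_pt ws s t /\ continuity_2d_pt wss s t) ->
  (forall s, s < 0 -> wt s (2 * PI) = wt s 0) ->
  RInt (u 1) 0 (2 * PI) = RInt (u 0) 0 (2 * PI).
Proof.
  intros Hu Hw Hper.
  assert (Hpi : 0 < 2 * PI) by (generalize PI_RGT_0; lra).
  assert (neg : forall s, s < 0 -> locally s (fun s => s < 0)) by (intros s; apply (open_lt 0)).
  assert (D1 : forall s, s < 0 ->
    is_derive (fun s => RInt (u (exp s)) 0 (2 * PI)) s (RInt (ws s) 0 (2 * PI))).
  { intros s Hs.
    replace (RInt (ws s) 0 (2 * PI)) with (RInt (fun t => Derive (fun s => u (exp s) t) s) 0 (2 * PI)).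
    2: { apply RInt_ext; intros t _; apply is_derive_unique, Hw, Hs. }
    apply (is_derive_RInt_param (fun s t => u (exp s) t)).
    - generalize (neg s Hs); apply filter_imp; intros y Hy t _; exists (ws y t); apply Hw, Hy.
    - intros t _; apply continuity_2d_pt_ext_loc with ws; [|apply Hw, Hs].
      destruct (neg s Hs) as [d Hd]; exists d; intros p q Hp _.
      symmetry; apply is_derive_unique, Hw, Hd, Hp.
    - apply filter_forall; intros y; apply (@ex_RInt_continuous R_CompleteNormedModule).
      intros z _; apply continuous_of_2d, Hu. }
  assert (D2 : forall s, s < 0 -> is_derive (fun s => RInt (ws s) 0 (2 * PI)) s 0).
  { intros s Hs.
    assert (E : RInt (fun t => Derive (fun s => ws s t) s) 0 (2 * PI) = 0).
    { apply is_RInt_unique.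
      apply is_RInt_ext with (fun t => opp (- wss s t)).
      { intros t _. symmetry; rewrite (is_derive_unique _ _ (wss s t)); [|apply Hw, Hs].
        unfold opp; simpl; ring. }
      (* The integrand is minus the [t]-derivative of [wt], so the integral is a difference of
         values at the two ends of a period. *)
      replace 0 with (opp (minus (wt s (2 * PI)) (wt s 0))) at 2
        by (rewrite Hper by assumption; unfold opp, minus, plus, opp; simpl; ring).
      apply (is_RInt_opp (V := R_NormedModule)), (is_RInt_derive (V := R_CompleteNormedModule)).
      - intros t _; apply Hw, Hs.
      - intros t _; apply (continuous_opp (V := R_NormedModule)), continuous_of_2d, Hw, Hs. }
    cut (is_derive (fun s => RInt (ws s) 0 (2 * PI)) s (RInt (fun t => Derive (fun s => ws s t) s) 0 (2 * PI))).
    { rewrite E; exact (fun h => h). }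
    apply (is_derive_RInt_param ws).
    - generalize (neg s Hs); apply filter_imp; intros y Hy t _; exists (wss y t); apply Hw, Hy.
    - intros t _; apply continuity_2d_pt_ext_loc with wss; [|apply Hw, Hs].
      destruct (neg s Hs) as [d Hd]; exists d; intros p q Hp _.
      symmetry; apply is_derive_unique, Hw, Hd, Hp.
    - generalize (neg s Hs); apply filter_imp; intros y Hy.
      apply (@ex_RInt_continuous R_CompleteNormedModule).
      intros z _; apply continuous_of_2d, Hw, Hy. }
  set (m := fun s => RInt (u (exp s)) 0 (2 * PI)) in *.
  assert (const : forall f : R -> R, (forall s, s < 0 -> is_derive f s 0) ->
    forall s t, s < 0 -> t < 0 -> f s = f t).
  { intros f Hf.
    assert (K : forall s t, t < 0 -> s < t -> f s = f t).
    { intros s t Ht Hst; apply (eq_is_derive (V := R_NormedModule)); [|exact Hst].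
      intros r Hr; apply Hf; lra. }
    intros s t Hs Ht; destruct (Rtotal_order s t) as [H|[H|H]];
      [apply K|rewrite H|symmetry; apply K]; auto. }
  set (B := RInt (ws (-1)) 0 (2 * PI)).
  assert (aff : forall s, s < 0 -> m s = m (-1) + B * (s + 1)).
  { intros s Hs.
    cut (m s - B * s = m (-1) - B * (-1)); [lra|].
    apply (const (fun s => m s - B * s)); try lra.
    intros t Ht. replace 0 with (minus (RInt (ws t) 0 (2 * PI)) B).
    - apply (is_derive_minus (V := R_NormedModule)); [apply D1, Ht|].
      auto_derive; [exact I|ring].
    - rewrite (const (fun s => RInt (ws s) 0 (2 * PI)) D2 t (-1)) by lra.
      unfold B, minus, plus, opp; simpl; ring. }
  assert (lim : forall r e, 0 < e -> exists d : posreal, forall s, Rabs (s - r) < d ->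
     Rabs (RInt (u s) 0 (2 * PI) - RInt (u r) 0 (2 * PI)) < e).
  { intros r e He.
    assert (He' : 0 < e / (2 * (2 * PI))) by (apply Rdiv_lt_0_compat; lra).
    destruct (continuous_RInt_param u 0 (2 * PI) r (Rlt_le _ _ Hpi) Hu (mkposreal _ He')) as [d Hd].
    exists d; intros s Hs; specialize (Hd s Hs); simpl in Hd.
    replace ((2 * PI - 0) * (e / (2 * (2 * PI)))) with (e / 2) in Hd by (field; lra). lra. }
  assert (small : forall d : posreal, exists s0, s0 < 0 /\ forall s, s <= s0 -> Rabs (exp s - 0) < d).
  { intros d; exists (Rmin (-1) (ln d - 1)); split.
    - generalize (Rmin_l (-1) (ln d - 1)); lra.
    - intros s Hs. rewrite Rminus_0_r, Rabs_pos_eq by (left; apply exp_pos).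
      rewrite <- (exp_ln d) by apply cond_pos. apply exp_increasing.
      generalize (Rmin_r (-1) (ln d - 1)); lra. }
  assert (HB : B = 0).
  { destruct (Req_dec B 0) as [H|H]; [exact H|exfalso].
    destruct (lim 0 1 Rlt_0_1) as [d Hd]. destruct (small d) as [s0 [Hs0 Hs]].
    assert (HBp := Rabs_pos_lt B H).
    (* Over the distance [n] an affine function of slope [B] changes by 3, whereas at [s0] and
       [s0 - n] it lies within 1 of the mean at [r = 0]. *)
    set (n := 3 / Rabs B).
    assert (Hn : 0 < n) by (apply Rdiv_lt_0_compat; lra).
    assert (K1 := Hd _ (Hs s0 (Rle_refl _))).
    assert (K2 := Hd _ (Hs (s0 - n) ltac:(lra))).
    fold (m s0) in K1. fold (m (s0 - n)) in K2.
    rewrite aff in K1, K2 by lra.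
    assert (K3 : Rabs (B * n) = 3) by (rewrite Rabs_mult, (Rabs_pos_eq n) by lra; unfold n; field; lra).
    apply Rabs_def2 in K1; apply Rabs_def2 in K2.
    assert (Rabs (B * n) < 2) by (apply Rabs_def1; lra). lra. }
  (* Both [r = 0] and [r = 1] are limits of [exp s] with [s < 0], so continuity of the mean in [r]
     carries the constant value to the center and to the boundary circle. *)
  assert (end_val : forall r, (forall d : posreal, exists s, s < 0 /\ Rabs (exp s - r) < d) ->
     RInt (u r) 0 (2 * PI) = m (-1)).
  { intros r Hr. apply cond_eq; intros e He.
    destruct (lim r e He) as [d Hd]. destruct (Hr d) as [s [Hs Hsd]].
    specialize (Hd _ Hsd). fold (m s) in Hd. rewrite aff, HB in Hd by assumption.
    rewrite Rabs_minus_sym. replace (m (-1)) with (m (-1) + 0 * (s + 1)) by ring. exact Hd. }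
  rewrite !end_val; [reflexivity| |].
  - intros d; destruct (small d) as [s [Hs K]]; exists s; split; [exact Hs|apply K, Rle_refl].
  - intros d.
    assert (C : continuity_pt exp 0) by (apply derivable_continuous_pt, derivable_pt_exp).
    destruct (proj1 (continuity_pt_locally exp 0) C d) as [e He].
    exists (- (e / 2)). generalize (cond_pos e); intros He0; split; [lra|].
    rewrite <- exp_0. apply He. change (Rabs (- (e / 2) - 0) < e).
    apply Rabs_def1; lra.
Qed.

(** * Homogeneous functions on cones and Euler's relations *)

Lemma coord_scal (a : axis) (t : R) (x : R3) : coord a (scal t x) = t * coord a x.
Proof. destruct x as [[? ?] ?], a; reflexivity. Qed.

Lemma coord_ext (x y : R3) : (forall a, coord a x = coord a y) -> x = y.
Proof.
  destruct x as [[? ?] ?], y as [[? ?] ?]; intros H.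
  generalize (H ax1) (H ax2) (H ax3); simpl; intros -> -> ->; reflexivity.
Qed.

Definition delta (a b : axis) : R :=
  match a, b with ax1, ax1 | ax2, ax2 | ax3, ax3 => 1 | _, _ => 0 end.

Lemma coord_upd (a b : axis) (x : R3) (t : R) :
  coord b (upd a x t) = coord b x + delta a b * (t - coord a x).
Proof. destruct x as [[? ?] ?], a, b; simpl; ring. Qed.

Lemma upd_coord (a : axis) (x : R3) : upd a x (coord a x) = x.
Proof. destruct x as [[? ?] ?], a; reflexivity. Qed.

Lemma is_derive_coord_upd (a b : axis) (x : R3) (s : R) :
  is_derive (fun t => coord b (upd a x t)) s (delta a b).
Proof.
  apply is_derive_ext with (fun t => coord b x + delta a b * (t - coord a x)).
  { intros t; symmetry; apply coord_upd. }
  auto_derive; [exact I|ring].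
Qed.

Lemma continuous_upd (a : axis) (x : R3) (s : R) : continuous (upd a x) s.
Proof.
  apply continuous_of_coord; intros b.
  apply (ex_derive_continuous (V := R_NormedModule)); exists (delta a b); apply is_derive_coord_upd.
Qed.

Lemma locally_upd (D : R3 -> Prop) (a : axis) (x : R3) :
  open D -> D x -> locally (coord a x) (fun t => D (upd a x t)).
Proof.
  intros HD Hx; apply (continuous_upd a x (coord a x) D), HD.
  rewrite upd_coord; exact Hx.
Qed.

Lemma sum3_ext (f g : axis -> R) : (forall a, f a = g a) -> sum3 f = sum3 g.
Proof. intros H; unfold sum3; rewrite !H; reflexivity. Qed.

Lemma is_derive_sum3 (f : axis -> R -> R) (d : axis -> R) (s : R) :
  (forall a, is_derive (f a) s (d a)) -> is_derive (fun t => sum3 (fun a => f a t)) s (sum3 d).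
Proof.
  intros H; unfold sum3.
  apply (is_derive_plus (V := R_NormedModule) (fun t => f ax1 t + f ax2 t) (f ax3)); [|apply H].
  apply (is_derive_plus (V := R_NormedModule)); apply H.
Qed.

Lemma is_derive_Rmult (f g : R -> R) (s df dg : R) :
  is_derive f s df -> is_derive g s dg ->
  is_derive (fun t => f t * g t) s (df * g s + f s * dg).
Proof. intros Hf Hg; apply (is_derive_mult f g s df dg Hf Hg Rmult_comm). Qed.

Lemma is_derive_eq (f : R -> R) (s d d' : R) : is_derive f s d -> d = d' -> is_derive f s d'.
Proof. intros H <-; exact H. Qed.

Definition positive_cone (D : R3 -> Prop) : Prop :=
  open D /\ forall (t : R) x, 0 < t -> D x -> D (scal t x).

(** The degree is [-k]: radial extensions have [k = 0], and each differentiation raises [k] by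
    one. *)
Definition homogeneous (D : R3 -> Prop) (k : nat) (f : R3 -> R) : Prop :=
  forall (t : R) x, 0 < t -> D x -> f (scal t x) = f x / t ^ k.

Definition has_partials (D : R3 -> Prop) (f : R3 -> R) (g : axis -> R3 -> R) : Prop :=
  (forall a x, D x -> is_derive (fun t => f (upd a x t)) (coord a x) (g a x)) /\
  (forall a x, D x -> continuous (g a) x).

Lemma chain_rule_on (D : R3 -> Prop) (f : R3 -> R) (g : axis -> R3 -> R) (X : R -> R3) (s : R) (d : axis -> R) :
  open D -> has_partials D f g -> D (X s) ->
  (forall a, is_derive (fun t => coord a (X t)) s (d a)) ->
  is_derive (fun t => f (X t)) s (sum3 (fun a => g a (X s) * d a)).
Proof.
  intros HD [Hf Hg] Hs; apply chain_rule.
  - generalize (HD _ Hs); apply filter_imp; intros y Hy a; apply Hf, Hy.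
  - intros a; apply Hg, Hs.
Qed.

Lemma second_derivative_along_curve (D : R3 -> Prop) (f : R3 -> R) (g : axis -> R3 -> R)
    (h : axis -> axis -> R3 -> R) (X : R -> R3) (d : axis -> R -> R) (dd : axis -> R) (s : R) :
  open D -> (forall a, has_partials D (g a) (h a)) -> D (X s) ->
  (forall a, is_derive (fun t => coord a (X t)) s (d a s)) ->
  (forall a, is_derive (d a) s (dd a)) ->
  is_derive (fun t => sum3 (fun a => g a (X t) * d a t)) s
    (sum3 (fun a => sum3 (fun b => h a b (X s) * d b s) * d a s + g a (X s) * dd a)).
Proof.
  intros HD Hg Hs Hd Hdd.
  apply (is_derive_sum3 (fun a t => g a (X t) * d a t)); intros a.
  apply is_derive_Rmult; [|apply Hdd].
  apply (chain_rule_on D); auto.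
Qed.

Lemma homogeneous_partial (D : R3 -> Prop) (k : nat) (f : R3 -> R) (g : axis -> R3 -> R) (a : axis) :
  positive_cone D -> homogeneous D k f -> has_partials D f g -> homogeneous D (S k) (g a).
Proof.
  intros [HD HC] Hf [Hg _] t x Ht Hx.
  assert (H : is_derive (fun u => f (upd a (scal t x) u)) (coord a (scal t x)) (g a x / t ^ S k)).
  { apply is_derive_ext_loc with (fun u => f (upd a x (u / t)) / t ^ k).
    - assert (L := locally_upd D a x HD Hx).
      assert (C : continuous (fun u => u / t) (coord a (scal t x))).
      { apply (ex_derive_continuous (V := R_NormedModule)); auto_derive; lra. }
      assert (E : coord a (scal t x) / t = coord a x) by (rewrite coord_scal; field; lra).
      unfold continuous in C; rewrite E in C.
      generalize (C _ L); unfold filtermap; apply filter_imp; intros u Hu.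
      rewrite <- Hf by assumption. f_equal; apply coord_ext; intros b.
      rewrite coord_scal, !coord_upd, !coord_scal; field; lra.
    - assert (K := Hg a x Hx).
      assert (E : coord a x = coord a (scal t x) / t) by (rewrite coord_scal; field; lra).
      rewrite E in K.
      apply is_derive_eq with (/ t ^ k * (/ t * g a x)).
      2: { simpl; field; split; [apply pow_nonzero|]; lra. }
      apply is_derive_ext with (fun u => / t ^ k * f (upd a x (u / t))).
      { intros u; apply Rmult_comm. }
      apply (is_derive_scal (fun u => f (upd a x (u / t)))).
      apply (is_derive_comp (V := R_NormedModule) (fun v => f (upd a x v)) (fun u => u / t)); [exact K|].
      auto_derive; lra. }
  rewrite <- (is_derive_unique _ _ _ H). symmetry; apply is_derive_unique, Hg, HC; assumption.
Qed.

Lemma euler_identity (D : R3 -> Prop) (k : nat) (f : R3 -> R) (g : axis -> R3 -> R) (x : R3) :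
  positive_cone D -> homogeneous D k f -> has_partials D f g -> D x ->
  sum3 (fun a => g a x * coord a x) = - INR k * f x.
Proof.
  intros [HD HC] Hf Hg Hx.
  assert (E1 : scal 1 x = x) by (apply (scal_one (K := R_AbsRing))).
  assert (H1 : is_derive (fun t => f (scal t x)) 1 (sum3 (fun a => g a (scal 1 x) * coord a x))).
  { apply (chain_rule_on D) with (X := fun t => scal t x); try assumption.
    - exact (eq_ind_r D Hx E1).
    - intros a; apply is_derive_ext with (fun t => t * coord a x).
      + intros t; symmetry; apply coord_scal.
      + generalize (coord a x); intros c; auto_derive; [exact I|ring]. }
  replace (sum3 _) with (sum3 (fun a => g a x * coord a x)) in H1
    by (unfold sum3; repeat f_equal; symmetry; exact E1).
  assert (H2 : is_derive (fun t => f (scal t x)) 1 (- INR k * f x)).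
  { apply is_derive_ext_loc with (fun t => f x / t ^ k).
    - generalize (open_gt 0 1 Rlt_0_1); apply filter_imp; intros t Ht; symmetry; apply Hf; assumption.
    - auto_derive; rewrite !pow1; [lra|field]. }
  rewrite <- (is_derive_unique _ _ _ H1). apply is_derive_unique, H2.
Qed.

(** Differentiating Euler's relation for [f] in the direction [b] contracts the first index of the
    Hessian [h]; Euler's relation for [g a] contracts the second one. *)
Lemma euler_identity_partial (D : R3 -> Prop) (f : R3 -> R) (g : axis -> R3 -> R)
    (h : axis -> axis -> R3 -> R) (b : axis) (x : R3) :
  positive_cone D -> homogeneous D 0 f -> has_partials D f g ->
  (forall a, has_partials D (g a) (h a)) -> D x ->
  sum3 (fun a => h a b x * coord a x) = - g b x.
Proof.
  intros HD Hf Hg Hh Hx.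
  assert (H1 : is_derive (fun t => sum3 (fun a => g a (upd b x t) * coord a (upd b x t))) (coord b x)
    (sum3 (fun a => h a b x * coord a x + g a x * delta b a))).
  { apply (is_derive_sum3 (fun a t => g a (upd b x t) * coord a (upd b x t))); intros a.
    apply is_derive_eq with (h a b x * coord a (upd b x (coord b x)) + g a (upd b x (coord b x)) * delta b a).
    - apply is_derive_Rmult; [apply Hh, Hx|apply is_derive_coord_upd].
    - rewrite upd_coord; reflexivity. }
  assert (H2 : is_derive (fun t => sum3 (fun a => g a (upd b x t) * coord a (upd b x t))) (coord b x) 0).
  { apply is_derive_ext_loc with (fun _ => 0); [|apply (is_derive_const (V := R_NormedModule) 0)].
    generalize (locally_upd D b x (proj1 HD) Hx); apply filter_imp; intros t Ht.
    rewrite (euler_identity D 0 f) by assumption; simpl; ring. }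
  assert (E : sum3 (fun a => h a b x * coord a x + g a x * delta b a) = 0).
  { rewrite <- (is_derive_unique _ _ _ H1). apply is_derive_unique, H2. }
  unfold sum3 in *; destruct b; cbv [delta] in E; lra.
Qed.

(** Serves to carry Laplace's equation from the unit sphere, where [beltrami] expresses it, to the
    whole cone in which the unnormalized null vectors move. *)
Lemma laplacian_homogeneous (D : R3 -> Prop) (f : R3 -> R) (g : axis -> R3 -> R)
    (h : axis -> axis -> R3 -> R) :
  positive_cone D -> homogeneous D 0 f -> has_partials D f g ->
  (forall a, has_partials D (g a) (h a)) ->
  homogeneous D 2 (fun x => sum3 (fun a => h a a x)).
Proof.
  intros HD Hf Hg Hh t x Ht Hx.
  assert (K : forall a, h a a (scal t x) = h a a x / t ^ 2).
  { intros a. apply (homogeneous_partial D 1 (g a) (h a) a); try assumption; [|apply Hh].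
    apply (homogeneous_partial D 0 f g); assumption. }
  unfold sum3; rewrite !K; field; lra.
Qed.

(* [Z] is the part of [Y] that is rotated; the tensor identity [HT] says that [Y] is a conformal
   parametrization of the sphere up to rescaling. *)
Lemma conformal_pullback_harmonic (D : R3 -> Prop) (f : R3 -> R) (g : axis -> R3 -> R)
    (h : axis -> axis -> R3 -> R) (Y : R3) (Ys Yt Yss Ytt Z : axis -> R) :
  positive_cone D -> homogeneous D 0 f -> has_partials D f g ->
  (forall a, has_partials D (g a) (h a)) -> D Y ->
  sum3 (fun a => h a a Y) = 0 ->
  (forall a b, Ys a * Ys b + Yt a * Yt b
     = delta a b + coord a Y * coord b Y - coord a Y * Z b - Z a * coord b Y) ->
  (forall a, Yss a + Ytt a = coord a Y - 2 * Z a) ->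
  sum3 (fun a => sum3 (fun b => h a b Y * Ys b) * Ys a + g a Y * Yss a)
  + sum3 (fun a => sum3 (fun b => h a b Y * Yt b) * Yt a + g a Y * Ytt a) = 0.
Proof.
  intros HD Hf Hg Hh HY HL HT HY2.
  assert (E0 := euler_identity D 0 f g Y HD Hf Hg HY).
  assert (E1 : forall a, sum3 (fun b => h a b Y * coord b Y) = - g a Y).
  { intros a. rewrite (euler_identity D 1 (g a) (h a)); auto; [simpl; ring|].
    apply (homogeneous_partial D 0 f); assumption. }
  assert (E2 := fun b => euler_identity_partial D f g h b Y HD Hf Hg Hh HY).
  transitivity (sum3 (fun a => sum3 (fun b => h a b Y * (Ys a * Ys b + Yt a * Yt b))
    + g a Y * (Yss a + Ytt a))); [unfold sum3; ring|].
  (* What the tensor identity adds to the trace of the Hessian contains [Y] as a factor. Euler's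
     relations turn these terms into first-order ones, which cancel against those coming from
     [Yss + Ytt]. *)
  transitivity (sum3 (fun a => h a a Y)
    + sum3 (fun a => sum3 (fun b => h a b Y * coord b Y) * (coord a Y - Z a))
    - sum3 (fun b => sum3 (fun a => h a b Y * coord a Y) * Z b)
    + sum3 (fun a => g a Y * coord a Y) - 2 * sum3 (fun a => g a Y * Z a)).
  { unfold sum3; rewrite !HT, !HY2; cbv [delta]; ring. }
  rewrite HL, E0, (sum3_ext _ (fun a => - g a Y * (coord a Y - Z a))),
    (sum3_ext (fun b => _ * Z b) (fun b => - g b Y * Z b)) by (intros; rewrite ?E1, ?E2; reflexivity).
  simpl INR in *; unfold sum3 in *; nra.
Qed.

(** * Continuity of composite real-valued functions *)

Section Continuity.
Context {U : UniformSpace}.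

Lemma continuous_Rplus (f g : U -> R) (x : U) :
  continuous f x -> continuous g x -> continuous (fun u => f u + g u) x.
Proof. apply (continuous_plus (V := R_NormedModule)). Qed.

Lemma continuous_Rminus (f g : U -> R) (x : U) :
  continuous f x -> continuous g x -> continuous (fun u => f u - g u) x.
Proof. apply (continuous_minus (V := R_NormedModule)). Qed.

Lemma continuous_Ropp (f : U -> R) (x : U) :
  continuous f x -> continuous (fun u => - f u) x.
Proof. apply (continuous_opp (V := R_NormedModule)). Qed.

Lemma continuous_Rmult (f g : U -> R) (x : U) :
  continuous f x -> continuous g x -> continuous (fun u => f u * g u) x.
Proof. apply (continuous_mult (K := R_AbsRing)). Qed.

Lemma continuous_R_comp (phi : R -> R) (f : U -> R) (x : U) :
  ex_derive phi (f x) -> continuous f x -> continuous (fun u => phi (f u)) x.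
Proof.
  intros H Hf; apply (continuous_comp f phi); [exact Hf|].
  apply (ex_derive_continuous (V := R_NormedModule)), H.
Qed.

Lemma continuous_sum3 (f : axis -> U -> R) (x : U) :
  (forall a, continuous (f a) x) -> continuous (fun u => sum3 (fun a => f a u)) x.
Proof. intros H; unfold sum3; repeat apply continuous_Rplus; apply H. Qed.

Lemma continuous_sum3_mult (g d : axis -> U -> R) (x : U) :
  (forall a, continuous (g a) x) -> (forall a, continuous (d a) x) ->
  continuous (fun u => sum3 (fun a => g a u * d a u)) x.
Proof. intros Hg Hd; apply (continuous_sum3 (fun a u => g a u * d a u)); intros a; apply continuous_Rmult; auto. Qed.

Lemma continuous_second_variation (h : axis -> axis -> U -> R) (g d dd : axis -> U -> R) (x : U) :
  (forall a b, continuous (h a b) x) -> (forall a, continuous (g a) x) ->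
  (forall a, continuous (d a) x) -> (forall a, continuous (dd a) x) ->
  continuous (fun u => sum3 (fun a => sum3 (fun b => h a b u * d b u) * d a u + g a u * dd a u)) x.
Proof.
  intros Hh Hg Hd Hdd.
  apply (continuous_sum3 (fun a u => sum3 (fun b => h a b u * d b u) * d a u + g a u * dd a u)); intros a.
  apply continuous_Rplus; apply continuous_Rmult; auto.
  apply continuous_sum3_mult; auto.
Qed.

End Continuity.

Lemma continuity_2d_of_continuous (f : R -> R -> R) (s t : R) :
  continuous (fun w : R * R => f (fst w) (snd w)) (s, t) -> continuity_2d_pt f s t.
Proof. intros H; apply continuity_2d_pt_filterlim, H. Qed.

Ltac continuity_R :=
  repeat match goal with
  | |- continuous (fun _ => ?c) _ => apply continuous_const
  | |- continuous (fun u => u) _ => apply continuous_id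
  | |- continuous (fun u => fst u) _ => apply continuous_fst
  | |- continuous (fun u => snd u) _ => apply continuous_snd
  | |- continuous (fun u => coord _ u) _ => apply continuous_coord
  | |- continuous (coord _) _ => apply continuous_coord
  | |- continuous cos _ => apply continuous_cos
  | |- continuous sin _ => apply continuous_sin
  | |- continuous fst _ => apply continuous_fst
  | |- continuous snd _ => apply continuous_snd
  | |- continuous (fun u => _ + _) _ => apply continuous_Rplus
  | |- continuous (fun u => _ - _) _ => apply continuous_Rminus
  | |- continuous (fun u => - _) _ => apply continuous_Ropp
  | |- continuous (fun u => _ * _) _ => apply continuous_Rmult
  | |- continuous (fun u => sum3 _) _ => apply continuous_sum3; intro
  | |- continuous (fun u => / _) _ => apply (continuous_R_comp Rinv); [auto_derive|]
  | |- continuous (fun u => cos _) _ => apply (continuous_R_comp cos); [auto_derive; exact I|]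
  | |- continuous (fun u => sin _) _ => apply (continuous_R_comp sin); [auto_derive; exact I|]
  | |- continuous (fun u => exp _) _ => apply (continuous_R_comp exp); [auto_derive; exact I|]
  | |- continuous (fun u => ln _) _ => apply (continuous_R_comp ln); [auto_derive|]
  end.

(** * Orthonormal frames *)

(** [frame_delta] is the completeness relation: the rows of the orthogonal matrix with columns [x],
    [v1], [v2] are orthonormal as well. Expansions in the frame and the conformality identity rest
    on it. *)
Record frame (x v1 v2 : R3) : Prop := {
  frame_xx : dot x x = 1; frame_11 : dot v1 v1 = 1; frame_22 : dot v2 v2 = 1;
  frame_x1 : dot x v1 = 0; frame_x2 : dot x v2 = 0; frame_12 : dot v1 v2 = 0;
  frame_delta : forall a b,
    coord a x * coord b x + coord a v1 * coord b v1 + coord a v2 * coord b v2 = delta a b }.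

Lemma dot_comm (x y : R3) : dot x y = dot y x.
Proof. unfold dot; ring. Qed.

Lemma frame_exists (x : R3) : dot x x = 1 -> exists v1 v2, frame x v1 v2.
Proof.
  destruct x as [[a b] c]; unfold dot; simpl; intros H.
  destruct (Req_dec c (-1)) as [E|E].
  - assert (a = 0) by nra. assert (b = 0) by nra. subst.
    exists (1, 0, 0), (0, 1, 0); split; try (unfold dot; simpl; ring).
    intros [] []; simpl; ring.
  - assert (E' : 1 + c <> 0) by lra.
    assert (Hm : / (1 + c) * (1 + c) = 1) by (field; exact E').
    set (m := / (1 + c)) in *; clearbody m.
    (* These are the images of the first two basis vectors under the reflection in the plane
       orthogonal to [x + e3], with [e3] the third basis vector; it sends [e3] to [-x] and breaks
       down only for [x = -e3], the case treated above. *)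
    exists (1 - a * a * m, - (a * b * m), - a), (- (a * b * m), 1 - b * b * m, - b).
    split; unfold dot; simpl; try (intros [] []; simpl); clear E E'; nsatz.
Qed.

Definition comb (x v1 v2 : R3) (f0 f1 f2 : R) : R3 :=
  (f0 * coord ax1 x + f1 * coord ax1 v1 + f2 * coord ax1 v2,
   f0 * coord ax2 x + f1 * coord ax2 v1 + f2 * coord ax2 v2,
   f0 * coord ax3 x + f1 * coord ax3 v1 + f2 * coord ax3 v2).

Lemma coord_comb (a : axis) (x v1 v2 : R3) (f0 f1 f2 : R) :
  coord a (comb x v1 v2 f0 f1 f2) = f0 * coord a x + f1 * coord a v1 + f2 * coord a v2.
Proof. destruct a; reflexivity. Qed.

Lemma dot_comb (x v1 v2 : R3) (f0 f1 f2 g0 g1 g2 : R) : frame x v1 v2 ->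
  dot (comb x v1 v2 f0 f1 f2) (comb x v1 v2 g0 g1 g2) = f0 * g0 + f1 * g1 + f2 * g2.
Proof.
  intros [Hxx H11 H22 Hx1 Hx2 H12 _].
  transitivity (f0 * g0 * dot x x + f1 * g1 * dot v1 v1 + f2 * g2 * dot v2 v2
    + (f0 * g1 + f1 * g0) * dot x v1 + (f0 * g2 + f2 * g0) * dot x v2 + (f1 * g2 + f2 * g1) * dot v1 v2).
  { unfold dot, comb; simpl; ring. }
  rewrite Hxx, H11, H22, Hx1, Hx2, H12; ring.
Qed.

Lemma frame_expansion (x v1 v2 y : R3) : frame x v1 v2 ->
  y = comb x v1 v2 (dot x y) (dot v1 y) (dot v2 y).
Proof.
  intros Hf; apply coord_ext; intros a; rewrite coord_comb.
  transitivity (sum3 (fun b => delta a b * coord b y)).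
  { unfold sum3; destruct a; cbv [delta]; ring. }
  rewrite (sum3_ext _ (fun b => (coord a x * coord b x + coord a v1 * coord b v1 + coord a v2 * coord b v2) * coord b y))
    by (intros b; rewrite (frame_delta _ _ _ Hf); reflexivity).
  unfold sum3, dot; ring.
Qed.

(** * Norms, unit vectors and the cone over a cap *)

Lemma dot_scal_r (t : R) (x y : R3) : dot x (scal t y) = t * dot x y.
Proof. unfold dot; rewrite !coord_scal; ring. Qed.

Lemma dot_self_nonneg (x : R3) : 0 <= dot x x.
Proof. unfold dot; generalize (coord ax1 x) (coord ax2 x) (coord ax3 x); intros; nra. Qed.

Lemma enorm_sqr (x : R3) : enorm x * enorm x = dot x x.
Proof. apply sqrt_sqrt, dot_self_nonneg. Qed.

Lemma enorm_eq (x : R3) (t : R) : 0 <= t -> dot x x = t * t -> enorm x = t.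
Proof. intros Ht H; unfold enorm; rewrite H; apply sqrt_square, Ht. Qed.

Lemma enorm_scal (t : R) (x : R3) : 0 <= t -> enorm (scal t x) = t * enorm x.
Proof.
  intros Ht; apply enorm_eq.
  - apply Rmult_le_pos; [exact Ht|apply sqrt_pos].
  - rewrite dot_scal_r, dot_comm, dot_scal_r, <- enorm_sqr; ring.
Qed.

Lemma Omega_dot (x : R3) : Omega x <-> dot x x = 1.
Proof.
  split; intros H.
  - rewrite <- enorm_sqr, H; ring.
  - apply enorm_eq; lra.
Qed.

Lemma enorm_pos (x : R3) : 0 < enorm x <-> x <> (0, 0, 0).
Proof.
  split.
  - intros H E; rewrite E in H; unfold enorm, dot in H; simpl in H.
    replace (0 * 0 + 0 * 0 + 0 * 0) with 0 in H by ring. rewrite sqrt_0 in H; lra.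
  - intros H; destruct (sqrt_pos (dot x x)) as [K|K]; [exact K|exfalso; apply H].
    assert (E : dot x x = 0) by (rewrite <- enorm_sqr; unfold enorm; rewrite <- K; ring).
    destruct x as [[a b] c]; unfold dot in E; simpl in E.
    replace a with 0 by nra; replace b with 0 by nra; replace c with 0 by nra; reflexivity.
Qed.

Lemma unit_of_scal (t : R) (x : R3) : 0 < t -> 0 < enorm x -> unit_of (scal t x) = unit_of x.
Proof.
  intros Ht Hx; apply coord_ext; intros a; unfold unit_of.
  rewrite enorm_scal by lra; rewrite !coord_scal; field; lra.
Qed.

Lemma unit_of_Omega (x : R3) : Omega x -> unit_of x = x.
Proof.
  intros H; apply coord_ext; intros a; unfold unit_of; rewrite coord_scal, H; field.
Qed.

Lemma Omega_unit_of (x : R3) : 0 < enorm x -> Omega (unit_of x).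
Proof.
  intros H; unfold Omega, unit_of; rewrite enorm_scal; [field; lra|].
  left; apply Rinv_0_lt_compat, H.
Qed.

Lemma dot_unit_of (z x : R3) : dot z (unit_of x) = dot z x / enorm x.
Proof. unfold unit_of; rewrite dot_scal_r; unfold Rdiv; ring. Qed.

Lemma cauchy_schwarz (x y : R3) : Omega x -> Omega y -> dot x y <= 1 /\ (dot x y = 1 -> x = y).
Proof.
  intros Hx Hy; apply Omega_dot in Hx; apply Omega_dot in Hy.
  assert (E : (coord ax1 x - coord ax1 y) ^ 2 + (coord ax2 x - coord ax2 y) ^ 2
    + (coord ax3 x - coord ax3 y) ^ 2 = 2 - 2 * dot x y) by (unfold dot in *; nra).
  assert (S1 := pow2_ge_0 (coord ax1 x - coord ax1 y)).
  assert (S2 := pow2_ge_0 (coord ax2 x - coord ax2 y)).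
  assert (S3 := pow2_ge_0 (coord ax3 x - coord ax3 y)).
  split; [lra|]. intros H; apply coord_ext.
  assert (Z : forall u v : R, (u - v) ^ 2 = 0 -> u = v) by (intros; nra).
  intros []; apply Z; lra.
Qed.

Lemma continuous_dot (z x : R3) : continuous (dot z) x.
Proof. unfold dot; continuity_R. Qed.

Lemma continuous_enorm (x : R3) : continuous enorm x.
Proof.
  apply (continuous_comp (fun x => dot x x) sqrt); [unfold dot; continuity_R|apply continuous_sqrt].
Qed.

Lemma cone_cap (rho : R) (z x : R3) :
  cone (cap rho z) x <-> 0 < enorm x /\ (1 - rho) * enorm x < dot z x.
Proof.
  unfold cone, cap; rewrite <- enorm_pos, dot_unit_of; split.
  - intros (H & _ & K); split; [exact H|].
    apply (Rmult_lt_reg_r (/ enorm x)); [apply Rinv_0_lt_compat, H|].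
    rewrite Rmult_assoc, Rinv_r by lra. unfold Rdiv in K; lra.
  - intros (H & K); repeat split; [exact H|apply Omega_unit_of, H|].
    apply (Rmult_lt_compat_r (/ enorm x)) in K; [|apply Rinv_0_lt_compat, H].
    rewrite Rmult_assoc, Rinv_r in K by lra. unfold Rdiv; lra.
Qed.

Lemma positive_cone_cap (rho : R) (z : R3) : positive_cone (cone (cap rho z)).
Proof.
  split.
  - assert (O : open (fun x => 0 < enorm x /\ 0 < dot z x - (1 - rho) * enorm x)).
    { apply open_and.
      - apply (open_comp enorm (fun r => 0 < r)); [|apply open_gt].
        intros y _; apply continuous_enorm.
      - apply (open_comp (fun x => dot z x - (1 - rho) * enorm x) (fun r => 0 < r)); [|apply open_gt].
        intros y _; apply (continuous_Rminus (dot z) (fun x => (1 - rho) * enorm x)); [apply continuous_dot|].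
        apply continuous_Rmult; [apply continuous_const|apply continuous_enorm]. }
    apply open_ext with (2 := O); intros x; rewrite cone_cap; lra.
  - intros t x Ht; rewrite !cone_cap, dot_scal_r, enorm_scal by lra; nra.
Qed.

Lemma radial_ext_homogeneous (D : R3 -> Prop) (f : R3 -> R) :
  (forall x, D x -> 0 < enorm x) -> homogeneous D 0 (radial_ext f).
Proof.
  intros HD t x Ht Hx; unfold radial_ext; rewrite unit_of_scal by auto; simpl; field.
Qed.

Lemma closure_continuous (A : R3 -> Prop) (phi : R3 -> R) (c : R) (x : R3) :
  continuous phi x -> (forall y, A y -> c <= phi y) -> closure A x -> c <= phi x.
Proof.
  intros Hc HA Hx; apply Rnot_lt_le; intros Hlt.
  destruct (Hc _ (open_lt c (phi x) Hlt)) as [e He].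
  destruct (Hx e) as [y [Hy Ay]].
  generalize (He y Hy) (HA y Ay); lra.
Qed.

Lemma closure_incl (A : R3 -> Prop) (x : R3) : A x -> closure A x.
Proof. intros H e; exists x; split; [apply ball_center|exact H]. Qed.

Lemma closure_Omega (A : R3 -> Prop) (x : R3) :
  (forall y, A y -> Omega y) -> closure A x -> Omega x.
Proof.
  intros HA Hx; apply Rle_antisym.
  - cut (- 1 <= - enorm x); [lra|].
    apply (closure_continuous A (fun y => - enorm y)); [apply continuous_Ropp, continuous_enorm| |exact Hx].
    intros y Hy; rewrite (HA y Hy); lra.
  - apply (closure_continuous A enorm); [apply continuous_enorm| |exact Hx].
    intros y Hy; rewrite (HA y Hy); lra.
Qed.

(** * The classes [Ck] and the Laplacian *)

Lemma continuous_on_continuous (D : R3 -> Prop) (f : R3 -> R) (x : R3) :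
  open D -> continuous_on D f -> D x -> continuous f x.
Proof.
  intros HD Hf Hx P HP; unfold filtermap.
  generalize (filter_and _ _ (Hf x Hx P HP : locally x (fun y => D y -> P (f y))) (HD x Hx)).
  apply filter_imp; intros y [H K]; apply H, K.
Qed.

(** As [X] takes all its values in [E], continuity relative to [E] becomes continuity of the
    composite. This gives access to the boundary circle, provided the parametrization never leaves
    the closed cap. *)
Lemma continuous_on_comp {S : UniformSpace} (E : R3 -> Prop) (f : R3 -> R) (X : S -> R3) (s : S) :
  continuous_on E f -> (forall s, E (X s)) -> continuous X s -> continuous (fun s => f (X s)) s.
Proof.
  intros Hf HX Hc P HP; unfold filtermap.
  generalize (Hc _ (Hf (X s) (HX s) P HP)); unfold within, filtermap.
  apply filter_imp; intros y H; apply H, HX.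
Qed.

Lemma Ck_incl (k : nat) (D E E' : R3 -> Prop) (f : R3 -> R) :
  (forall x, E' x -> E x) -> Ck k D E f -> Ck k D E' f.
Proof.
  intros HE; revert f; induction k as [|k IH]; intros f [Hc H]; split; try exact I.
  1, 2: intros x Hx P HP; generalize (Hc x (HE x Hx) P HP); unfold filtermap, within;
    apply filter_imp; intros y K Hy; apply K, HE, Hy.
  intros a; destruct (H a) as [g [Hg Kg]]; exists g; split; [exact Hg|apply IH, Kg].
Qed.

Lemma Ck_minus (k : nat) (D E : R3 -> Prop) (f g : R3 -> R) :
  Ck k D E f -> Ck k D E g -> Ck k D E (fun x => f x - g x).
Proof.
  assert (C : forall f g : R3 -> R, continuous_on E f -> continuous_on E g -> continuous_on E (fun x => f x - g x)).
  { intros f' g' Hf Hg x Hx.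
    apply (filterlim_comp_2 f' (fun y => - g' y) Rplus (Hf x Hx)
      (filterlim_comp _ _ _ g' Ropp _ _ _ (Hg x Hx) (filterlim_opp (V := R_NormedModule) (g' x)))).
    apply (filterlim_plus (V := R_NormedModule) (f' x) (- g' x)). }
  revert f g; induction k as [|k IH]; intros f g [Cf Hf] [Cg Hg]; (split; [apply C; assumption|]); [exact I|].
  intros a; destruct (Hf a) as [f' [Df Kf]], (Hg a) as [g' [Dg Kg]].
  exists (fun x => f' x - g' x); split; [|apply IH; assumption].
  intros x Hx; apply (is_derive_minus (V := R_NormedModule)); [apply Df|apply Dg]; exact Hx.
Qed.

Lemma Ck_partials (k : nat) (D : R3 -> Prop) (f : R3 -> R) :
  open D -> Ck (S k) D D f ->
  exists g, has_partials D f g /\ forall a, Ck k D D (g a).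
Proof.
  intros HD [_ H].
  destruct (H ax1) as [g1 [D1 K1]], (H ax2) as [g2 [D2 K2]], (H ax3) as [g3 [D3 K3]].
  exists (fun a => match a with ax1 => g1 | ax2 => g2 | ax3 => g3 end).
  split; [split|]; intros [] **; try (eapply continuous_on_continuous; [exact HD| |eassumption]); auto.
  destruct k; apply K1. destruct k; apply K2. destruct k; apply K3.
Qed.

Lemma Ck2_partials (D : R3 -> Prop) (f : R3 -> R) : open D -> Ck 2 D D f ->
  exists g h, has_partials D f g /\ forall a, has_partials D (g a) (h a).
Proof.
  intros HD H; destruct (Ck_partials 1 D f HD H) as [g [Hg K]].
  destruct (Ck_partials 0 D (g ax1) HD (K ax1)) as [h1 [H1 _]].
  destruct (Ck_partials 0 D (g ax2) HD (K ax2)) as [h2 [H2 _]].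
  destruct (Ck_partials 0 D (g ax3) HD (K ax3)) as [h3 [H3 _]].
  exists g, (fun a => match a with ax1 => h1 | ax2 => h2 | ax3 => h3 end).
  split; [exact Hg|intros []; assumption].
Qed.

Lemma laplacian_partials (D : R3 -> Prop) (f : R3 -> R) (g : axis -> R3 -> R)
    (h : axis -> axis -> R3 -> R) (x : R3) :
  open D -> has_partials D f g -> (forall a, has_partials D (g a) (h a)) -> D x ->
  laplacian f x = sum3 (fun a => h a a x).
Proof.
  intros HD [Hg _] Hh Hx.
  assert (E : forall a, partial a (partial a f) x = h a a x).
  { intros a; apply is_derive_unique, is_derive_ext_loc with (fun t => g a (upd a x t)); [|apply Hh, Hx].
    generalize (locally_upd D a x HD Hx); apply filter_imp; intros t Ht.
    symmetry; apply is_derive_unique, Hg, Ht. }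
  unfold laplacian; rewrite !E; reflexivity.
Qed.

Lemma laplacian_minus (D : R3 -> Prop) (f g : R3 -> R) (x : R3) :
  open D -> Ck 2 D D f -> Ck 2 D D g -> D x ->
  laplacian (fun x => f x - g x) x = laplacian f x - laplacian g x.
Proof.
  intros HD Hf Hg Hx.
  destruct (Ck2_partials D f HD Hf) as (f1 & f2 & F1 & F2).
  destruct (Ck2_partials D g HD Hg) as (g1 & g2 & G1 & G2).
  assert (M : forall u v u' v', has_partials D u u' -> has_partials D v v' ->
    has_partials D (fun x => u x - v x) (fun a x => u' a x - v' a x)).
  { intros u v u' v' [Du Cu] [Dv Cv]; split; intros a y Hy.
    - apply (is_derive_minus (V := R_NormedModule)); [apply Du|apply Dv]; exact Hy.
    - apply continuous_Rminus; auto. }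
  rewrite (laplacian_partials D _ _ (fun a b x => f2 a b x - g2 a b x) x HD (M _ _ _ _ F1 G1)
    (fun a => M _ _ _ _ (F2 a) (G2 a)) Hx).
  rewrite (laplacian_partials D f f1 f2), (laplacian_partials D g g1 g2) by assumption.
  unfold sum3; ring.
Qed.

(** * Angles determined by cosine and sine *)

Lemma angle_exists (C S : R) : C * C + S * S = 1 ->
  exists t, 0 <= t <= 2 * PI /\ cos t = C /\ sin t = S.
Proof.
  intros H.
  assert (HC : -1 <= C <= 1) by nra.
  assert (E : sqrt (1 - C²) = Rabs S).
  { replace (1 - C²) with (S²) by (unfold Rsqr; lra). apply sqrt_Rsqr_abs. }
  assert (B := acos_bound C). assert (P := PI_RGT_0).
  destruct (Rle_dec 0 S) as [HS|HS].
  - exists (acos C); split; [lra|split; [apply cos_acos, HC|]].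
    rewrite sin_acos, E by exact HC; apply Rabs_pos_eq, HS.
  - exists (2 * PI - acos C); split; [lra|].
    rewrite cos_minus, sin_minus, cos_2PI, sin_2PI, cos_acos, sin_acos, E, Rabs_left by lra.
    split; ring.
Qed.

Lemma angle_unique (s t : R) : 0 <= s < 2 * PI -> 0 <= t < 2 * PI ->
  cos s = cos t -> sin s = sin t -> s = t.
Proof.
  assert (K : forall s t, 0 <= s -> s < t -> t < 2 * PI -> cos s = cos t -> sin s = sin t -> False).
  { intros a b Ha Hab Hb Hc Hs.
    (* Equal cosines and sines force [cos (b - a) = 1], hence [sin ((b - a) / 2) = 0], although the
       half difference lies strictly between 0 and [PI]. *)
    assert (P : 0 < sin ((b - a) / 2)) by (apply sin_gt_0; lra).
    assert (E : cos (b - a) = 1).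
    { rewrite cos_minus, Hc, Hs, Rplus_comm. apply (sin2_cos2 b). }
    replace (b - a) with (2 * ((b - a) / 2)) in E by field.
    rewrite cos_2a_sin in E. nra. }
  intros Hs Ht Hc Hn; destruct (Rtotal_order s t) as [L|[L|L]]; [exfalso|exact L|exfalso].
  - apply (K s t); lra.
  - apply (K t s); lra.
Qed.

(** * Conformal polar coordinates of a cap *)

Section Polar.

Variables (rho : R) (z x v1 v2 : R3).
Hypotheses (Hrho : 0 < rho < 2) (Hz : Omega z) (Hx : cap rho z x) (Hfr : frame x v1 v2).

(** The boundary circle lies in the plane [z.eta = h] and has radius [w]. The coordinates of [z] in
    the frame are [p], [z1], [z2], and [D > 0] expresses that [x] is inside the cap. *)
Let h := 1 - rho.
Let p := dot x z.
Let z1 := dot v1 z.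
Let z2 := dot v2 z.
Let D := p - h.
Let w := sqrt (rho * (2 - rho)).
(** Normalized by [2 k^2 (|Q| - Q.x) = 1], where [|Q| - Q.x = q D]. Then
    [k e^-s (1, x) + k e^s (|Q|, Q)] has Minkowski square [-1] for every [s], which balances the
    unit square of the rotating vector. *)
Let k := w / (2 * D).
Let q := 2 * D / (rho * (2 - rho)).
(** The rotating vector is [(c t, c t x + cos t v1 + sin t v2)]: the multiple [c t] of [(1, x)]
    makes it orthogonal to the mirror image of [(1, x)] and changes neither its square nor its
    orthogonality to [(1, x)]. [c'] is the derivative of [c]. *)
Let c t := - (z1 * cos t + z2 * sin t) / D.
Let c' t := (z1 * sin t - z2 * cos t) / D.

(* [(T r t, V r t)] is a null vector of Minkowski space, so [V r t / T r t] lies on the sphere.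
   It is the sum of a multiple of [(1, x)], a multiple of its mirror image [(r_check, r_check * xi_check)]
   in the hyperplane of the boundary circle, and a vector rotating in the plane orthogonal to both. *)
Let V (r t : R) : R3 :=
  comb x v1 v2 (k + r * c t + k * r ^ 2 * (1 - q * p)) (r * cos t - k * r ^ 2 * q * z1)
    (r * sin t - k * r ^ 2 * q * z2).
Let T (r t : R) : R := k + r * c t + k * r ^ 2 * (1 - q * h).

Lemma polar_D_pos : 0 < D.
Proof. destruct Hx as [_ H]; unfold D, p, h; rewrite dot_comm; lra. Qed.

Lemma polar_w_pos : 0 < w.
Proof. apply sqrt_lt_R0; nra. Qed.

Lemma polar_w_sqr : w * w = rho * (2 - rho).
Proof. apply sqrt_sqrt; nra. Qed.

Lemma polar_k_pos : 0 < k.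
Proof. apply Rdiv_lt_0_compat; [apply polar_w_pos|generalize polar_D_pos; lra]. Qed.

Lemma polar_pole : p * p + z1 * z1 + z2 * z2 = 1.
Proof.
  rewrite <- (dot_comb x v1 v2 p z1 z2 p z1 z2 Hfr).
  unfold p, z1, z2; rewrite <- frame_expansion by exact Hfr.
  apply Omega_dot, Hz.
Qed.

Lemma polar_kkq : k * k * q = 1 / (2 * D).
Proof.
  unfold k, q. rewrite <- polar_w_sqr.
  generalize polar_D_pos polar_w_pos; intros; field; lra.
Qed.

Lemma polar_4kk : 4 * (k * k) = rho * (2 - rho) / (D * D).
Proof.
  unfold k. rewrite <- polar_w_sqr.
  generalize polar_D_pos polar_w_pos; intros; field; lra.
Qed.

Lemma polar_ck : 4 * (k * k) * (1 - q * h) = (1 - p * p) / (D * D) + 1.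
Proof.
  transitivity (4 * (k * k) - 4 * (k * k * q) * h); [ring|].
  rewrite polar_kkq, polar_4kk.
  generalize polar_D_pos; intros HD.
  replace (rho * (2 - rho)) with (1 - h * h) by (unfold h; ring).
  replace p with (D + h) by (unfold D; ring). field; lra.
Qed.

Lemma polar_cc (t : R) : c t * c t + c' t * c' t = (1 - p * p) / (D * D).
Proof.
  replace (1 - p * p) with (z1 * z1 + z2 * z2) by (generalize polar_pole; lra).
  generalize polar_D_pos; intros HD. unfold c, c'.
  generalize (sin2_cos2 t); unfold Rsqr; intros E.
  replace (z1 * z1 + z2 * z2) with ((z1 * z1 + z2 * z2) * (sin t * sin t + cos t * cos t)) by (rewrite E; ring).
  field; lra.
Qed.

(** Completing the square in [r] gives [4 k T = (2 k + r c)^2 + r^2 (1 + c'^2)]; the last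
    coefficient comes from [polar_ck] and [polar_cc]. *)
Lemma polar_T_pos (r t : R) : 0 < T r t.
Proof.
  assert (Hk := polar_k_pos). assert (E := polar_ck). assert (Ec := polar_cc t).
  apply (Rmult_lt_reg_l (4 * k)); [lra|]. rewrite Rmult_0_r.
  replace (4 * k * T r t) with ((2 * k + r * c t) ^ 2 + r ^ 2 * (4 * (k * k) * (1 - q * h) - c t * c t))
    by (unfold T; ring).
  replace (4 * (k * k) * (1 - q * h) - c t * c t) with (1 + c' t * c' t) by lra.
  destruct (Req_dec r 0) as [->|Hr]; [nra|].
  apply Rplus_le_lt_0_compat; [apply pow2_ge_0|].
  apply Rmult_lt_0_compat; [apply pow2_gt_0, Hr|nra].
Qed.

Lemma polar_V_sqr (r t : R) : dot (V r t) (V r t) = T r t * T r t.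
Proof.
  unfold V; rewrite dot_comb by exact Hfr.
  assert (K1 := polar_kkq). assert (HD := polar_D_pos). assert (P := polar_pole).
  assert (E : D * c t = - (z1 * cos t + z2 * sin t)) by (unfold c; field; lra).
  assert (Hq : D * (k * k * q) = 1 / 2) by (rewrite K1; field; lra).
  generalize (sin2_cos2 t); unfold Rsqr; intros SC.
  assert (Hd : D = p - h) by reflexivity.
  assert (Hqq : rho * (2 - rho) * q = 2 * D) by (unfold q; field; lra).
  assert (Hh : rho * (2 - rho) = 1 - h * h) by (unfold h; ring). rewrite Hh in Hqq.
  unfold T. generalize (c t) E; intros ct E'.
  clear -P Hq SC Hd Hqq E'. clearbody p z1 z2 D q k h.
  set (C := cos t) in *; set (S := sin t) in *; clearbody C S.
  assert (Q : q * q * (1 - h * h) = 2 * D * q) by (rewrite <- Hqq; ring).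
  (* Sorted by powers of [r]: the quadratic terms balance the normalization of [k] against the unit
     rotating vector, the cubic ones express its orthogonality to the mirror vector, the quartic one
     that the mirror vector is null. *)
  cut (2 * k * r ^ 2 * (k * q * D) + 2 * (r * ct) * (k * r ^ 2) * q * D + 2 * k * r ^ 3 * q * (z1 * C + z2 * S) - r ^ 2 * (C * C + S * S)
       + k * k * r ^ 4 * ((1 - q * h) ^ 2 - (1 - q * p) ^ 2 - q * q * (z1 * z1 + z2 * z2)) = 0).
  { intros H; symmetry; apply Rminus_diag_uniq; etransitivity; [|exact H]; rewrite Hd; ring. }
  replace (z1 * C + z2 * S) with (- (D * ct)) by lra.
  replace (z1 * z1 + z2 * z2) with (1 - p * p) by lra.
  replace ((1 - q * h) ^ 2 - (1 - q * p) ^ 2 - q * q * (1 - p * p)) with (2 * q * (p - h) - q * q * (1 - h * h)) by ring.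
  rewrite Q, <- Hd. replace (C * C + S * S) with 1 by lra.
  replace (2 * k * r ^ 2 * (k * q * D)) with (2 * r ^ 2 * (D * (k * k * q))) by ring.
  rewrite Hq. field.
Qed.

Lemma polar_enorm_V (r t : R) : enorm (V r t) = T r t.
Proof. apply enorm_eq; [left; apply polar_T_pos|apply polar_V_sqr]. Qed.

(** This is the Minkowski product with the normal [(h, z)] of the boundary hyperplane. The rotating
    vector is orthogonal to the normal, and [(1, x)] and its mirror image contribute [D] and [-D];
    so the factor [1 - r^2] separates interior from boundary. *)
Lemma polar_dot_z (r t : R) : dot z (V r t) = h * T r t + D * k * (1 - r ^ 2).
Proof.
  rewrite (frame_expansion x v1 v2 z Hfr). fold p z1 z2.
  unfold V; rewrite dot_comb by exact Hfr.
  assert (HD := polar_D_pos). assert (P := polar_pole).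
  assert (E : D * c t = - (z1 * cos t + z2 * sin t)) by (unfold c; field; lra).
  assert (Hqq : rho * (2 - rho) * q = 2 * D) by (unfold q; field; lra).
  replace (rho * (2 - rho)) with (1 - h * h) in Hqq by (unfold h; ring).
  transitivity (p * (k + r * c t) + r * (z1 * cos t + z2 * sin t) + k * r ^ 2 * (p - q * (p * p + z1 * z1 + z2 * z2)));
    [ring|]. rewrite P.
  replace (z1 * cos t + z2 * sin t) with (- (D * c t)) by lra.
  unfold T. replace p with (D + h) by (unfold D; ring).
  replace (D + h - q * 1) with (D + h - q * (h * h) - (1 - h * h) * q) by ring.
  rewrite Hqq. ring.
Qed.

(** In the Minkowski product with [(1, x)] only the mirror vector survives. For [r = 1] this reads
    [1 - x.eta = D / (w T)] at the boundary point [eta = V / T], the source of the Poisson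
    kernel. *)
Lemma polar_dot_x (r t : R) : dot x (V r t) = T r t - D / w * r ^ 2.
Proof.
  rewrite (frame_expansion x v1 v2 x Hfr) at 1.
  rewrite (frame_xx _ _ _ Hfr), (dot_comm v1 x), (dot_comm v2 x), (frame_x1 _ _ _ Hfr), (frame_x2 _ _ _ Hfr).
  unfold V; rewrite dot_comb by exact Hfr.
  assert (HD := polar_D_pos). assert (Hw := polar_w_pos).
  assert (E : D / w = k * q * D).
  { unfold k, q. rewrite <- polar_w_sqr. field; lra. }
  rewrite E; unfold T, D; ring.
Qed.

Lemma polar_dot_v1 (r t : R) : dot v1 (V r t) = r * cos t - k * r ^ 2 * q * z1.
Proof.
  rewrite (frame_expansion x v1 v2 v1 Hfr) at 1.
  rewrite (frame_11 _ _ _ Hfr), (dot_comm v2 v1), (frame_12 _ _ _ Hfr), (frame_x1 _ _ _ Hfr).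
  unfold V; rewrite dot_comb by exact Hfr; ring.
Qed.

Lemma polar_dot_v2 (r t : R) : dot v2 (V r t) = r * sin t - k * r ^ 2 * q * z2.
Proof.
  rewrite (frame_expansion x v1 v2 v2 Hfr) at 1.
  rewrite (frame_22 _ _ _ Hfr), (frame_12 _ _ _ Hfr), (frame_x2 _ _ _ Hfr).
  unfold V; rewrite dot_comb by exact Hfr; ring.
Qed.

Lemma polar_interior (r t : R) : 0 <= r < 1 -> cone (cap rho z) (V r t).
Proof.
  intros Hr; rewrite cone_cap, polar_enorm_V, polar_dot_z; fold h.
  generalize (polar_T_pos r t) polar_D_pos polar_k_pos; intros; split; [assumption|].
  assert (0 < D * k) by nra. assert (r ^ 2 < 1) by nra. nra.
Qed.

Lemma polar_kq : k * q = / w.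
Proof.
  unfold k, q; rewrite <- polar_w_sqr.
  generalize polar_D_pos polar_w_pos; intros; field; lra.
Qed.

(** The product with [x] determines [T], hence [V], whose components along [v1] and [v2] determine
    [cos t] and [sin t]. *)
Lemma polar_circle_unique (s t : R) : 0 <= s < 2 * PI -> 0 <= t < 2 * PI ->
  unit_of (V 1 s) = unit_of (V 1 t) -> s = t.
Proof.
  intros Hs Ht E.
  assert (HD := polar_D_pos). assert (Hw := polar_w_pos).
  assert (HK : 0 < D / w) by (apply Rdiv_lt_0_compat; assumption).
  assert (Ps := polar_T_pos 1 s). assert (Pt := polar_T_pos 1 t).
  assert (ET : T 1 s = T 1 t).
  { assert (K := f_equal (dot x) E).
    rewrite !dot_unit_of, !polar_dot_x, !polar_enorm_V in K.
    apply (Rmult_eq_reg_l (D / w)); [|lra].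
    apply (Rmult_eq_reg_r (/ (T 1 s * T 1 t))); [|apply Rinv_neq_0_compat; nra].
    apply Rminus_diag_uniq; apply Rminus_diag_eq in K. rewrite <- K. field; lra. }
  assert (EV : forall v, dot v (V 1 s) = dot v (V 1 t)).
  { intros v; assert (K := f_equal (dot v) E).
    rewrite !dot_unit_of, !polar_enorm_V, ET in K.
    apply (Rmult_eq_reg_r (/ T 1 t)); [exact K|apply Rinv_neq_0_compat; lra]. }
  assert (E1 := EV v1). rewrite !polar_dot_v1 in E1.
  assert (E2 := EV v2). rewrite !polar_dot_v2 in E2.
  apply angle_unique; try assumption; lra.
Qed.

Lemma polar_circle_exists (y : R3) : Omega y -> dot z y = h ->
  exists t, 0 <= t <= 2 * PI /\ unit_of (V 1 t) = y.
Proof.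
  intros Hy Hzy.
  assert (HD := polar_D_pos). assert (Hw := polar_w_pos). assert (Hkq := polar_kq).
  assert (Hww := polar_w_sqr). replace (rho * (2 - rho)) with (1 - h * h) in Hww by (unfold h; ring).
  assert (P := polar_pole).
  set (y0 := dot x y). set (y1 := dot v1 y). set (y2 := dot v2 y).
  assert (Ny : y0 * y0 + y1 * y1 + y2 * y2 = 1).
  { rewrite <- (dot_comb x v1 v2 y0 y1 y2 y0 y1 y2 Hfr). unfold y0, y1, y2.
    rewrite <- frame_expansion by exact Hfr. apply Omega_dot, Hy. }
  assert (Nz : p * y0 + z1 * y1 + z2 * y2 = h).
  { rewrite <- Hzy, <- (dot_comb x v1 v2 p z1 z2 y0 y1 y2 Hfr). unfold y0, y1, y2, p, z1, z2.
    rewrite <- !frame_expansion by exact Hfr. reflexivity. }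
  assert (H0 : y0 < 1).
  { destruct (cauchy_schwarz x y) as [[H|H] Heq]; [apply Hx|exact Hy|exact H|exfalso].
    rewrite <- (Heq H), dot_comm in Hzy. unfold D, p in HD; lra. }
  (* The only possible value of [T], by [polar_dot_x] at [r = 1]; the components of [m y] along [v1]
     and [v2] then prescribe the cosine and sine of [t]. *)
  set (m := D / w / (1 - y0)).
  assert (Hm : w * m = D + w * m * y0) by (unfold m; field; lra).
  assert (Hd : D = p - h) by reflexivity.
  assert (Pm : 0 < m) by (apply Rdiv_lt_0_compat; [apply Rdiv_lt_0_compat|]; lra).
  assert (W : / w * w = 1) by (field; lra).
  destruct (angle_exists (m * y1 + / w * z1) (m * y2 + / w * z2)) as (t & Ht & Hc & Hs).
  { set (i := / w) in *. clearbody i m y0 y1 y2. clear -Hww P Ny Nz Hm Hd W Hw.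
    clearbody h p z1 z2 D w.
    assert (K : w * w * ((m * y1 + i * z1) * (m * y1 + i * z1) + (m * y2 + i * z2) * (m * y2 + i * z2)) = w * w * 1).
    { replace (w * w * ((m * y1 + i * z1) * (m * y1 + i * z1) + (m * y2 + i * z2) * (m * y2 + i * z2))) with
        ((w * m) * (w * m) * (y1 * y1 + y2 * y2) + 2 * (w * m) * (i * w) * (z1 * y1 + z2 * y2)
          + (i * w) * (i * w) * (z1 * z1 + z2 * z2)) by ring.
      rewrite W, Hww. replace (y1 * y1 + y2 * y2) with (1 - y0 * y0) by lra.
      replace (z1 * y1 + z2 * y2) with (h - p * y0) by lra.
      replace (z1 * z1 + z2 * z2) with (1 - p * p) by lra.
      set (n := w * m) in *. assert (Hn : n * y0 = n - D) by lra.
      replace (n * n * (1 - y0 * y0) + 2 * n * 1 * (h - p * y0) + 1 * 1 * (1 - p * p)) with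
        (n * n - (n * y0) * (n * y0) + 2 * n * h - 2 * p * (n * y0) + 1 - p * p) by ring.
      rewrite Hn, Hd; ring. }
    apply Rmult_eq_reg_l in K; [exact K|nra]. }
  exists t; split; [exact Ht|].
  assert (E : V 1 t = scal m y).
  { rewrite (frame_expansion x v1 v2 (V 1 t) Hfr), (frame_expansion x v1 v2 (scal m y) Hfr).
    rewrite !dot_scal_r, polar_dot_v1, polar_dot_v2, polar_dot_x. fold y0 y1 y2.
    replace (k * 1 ^ 2 * q * z1) with (/ w * z1) by (rewrite <- Hkq; ring).
    replace (k * 1 ^ 2 * q * z2) with (/ w * z2) by (rewrite <- Hkq; ring).
    rewrite Hc, Hs. f_equal; try ring.
    cut (T 1 t = m); [intros ->; unfold m; field; lra|].
    unfold T, c. rewrite Hc, Hs.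
    replace (k + 1 * (- (z1 * (m * y1 + / w * z1) + z2 * (m * y2 + / w * z2)) / D) + k * 1 ^ 2 * (1 - q * h)) with
      (2 * k - k * q * h - (m * (z1 * y1 + z2 * y2) + / w * (z1 * z1 + z2 * z2)) / D) by (field; lra).
    rewrite Hkq. replace (z1 * z1 + z2 * z2) with (1 - p * p) by lra.
    replace (z1 * y1 + z2 * y2) with (h - p * y0) by lra.
    replace (2 * k) with (w * w / (w * D)) by (unfold k; field; lra). rewrite Hww.
    replace (m * (h - p * y0)) with ((w * m * h - p * (w * m * y0)) / w) by (field; lra).
    replace (w * m * y0) with (w * m - D) by lra.
    replace p with (D + h) by lra. field; lra. }
  rewrite E, unit_of_scal, unit_of_Omega; [reflexivity|exact Hy|exact Pm|].
  rewrite Hy; lra.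
Qed.

Lemma polar_circle_boundary (t : R) : Omega (unit_of (V 1 t)) /\ dot z (unit_of (V 1 t)) = h.
Proof.
  assert (P := polar_T_pos 1 t).
  split; [apply Omega_unit_of; rewrite polar_enorm_V; exact P|].
  rewrite dot_unit_of, polar_dot_z, polar_enorm_V; field; lra.
Qed.

Lemma continuous_unit_of (y : R3) : 0 < enorm y -> continuous unit_of y.
Proof.
  intros Hy; apply continuous_of_coord; intros a.
  apply continuous_ext with (fun u => / enorm u * coord a u).
  { intros u; symmetry; apply coord_scal. }
  apply continuous_Rmult; [|apply continuous_coord].
  apply (continuous_R_comp Rinv); [auto_derive; lra|apply continuous_enorm].
Qed.

Lemma continuous_polar {S : UniformSpace} (r t : S -> R) (s : S) :
  continuous r s -> continuous t s -> continuous (fun s => V (r s) (t s)) s.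
Proof.
  intros Hr Ht; apply continuous_of_coord; intros a.
  eapply continuous_ext; [intros u; symmetry; apply coord_comb|].
  unfold c, pow, Rdiv; continuity_R; assumption.
Qed.

(** A point of the boundary circle is the limit, as [r] tends to 1, of the points [unit_of (V r t)]
    on its own radial curve, which lie in the cap. *)
Lemma closure_cap_aux (y : R3) :
  closure (cap rho z) y <-> Omega y /\ h <= dot z y.
Proof.
  split.
  - intros H; split.
    + apply (closure_Omega (cap rho z)); [intros u [Hu _]; exact Hu|exact H].
    + apply (closure_continuous (cap rho z)); [apply continuous_dot| |exact H].
      intros u [_ Hu]; unfold h; lra.
  - intros [Hy Hzy]; destruct Hzy as [Hzy|Hzy].
    + apply closure_incl; split; [exact Hy|unfold h in Hzy; lra].
    + destruct (polar_circle_exists y Hy (eq_sym Hzy)) as (t & _ & <-).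
      intros e.
      assert (C : continuous (fun r => unit_of (V r t)) 1).
      { apply (continuous_comp (fun r => V r t) unit_of).
        - apply (continuous_polar (fun r => r) (fun _ => t)); [apply continuous_id|apply continuous_const].
        - apply continuous_unit_of; rewrite polar_enorm_V; apply polar_T_pos. }
      destruct (C (fun u => ball (unit_of (V 1 t)) e u)) as [d Hd]; [exists e; intros u Hu; exact Hu|].
      assert (Hr : exists r, 0 <= r < 1 /\ Rabs (r - 1) < d).
      { exists (Rmax 0 (1 - d / 2)). generalize (cond_pos d); intros P.
        unfold Rmax; destruct (Rle_dec 0 (1 - d / 2)); unfold Rabs; destruct Rcase_abs; lra. }
      destruct Hr as (r & Hr & Hrd).
      exists (unit_of (V r t)); split; [apply Hd, Hrd|].
      apply (polar_interior r t Hr).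
Qed.

Lemma sphere_boundary_cap_aux (y : R3) :
  sphere_boundary (cap rho z) y <-> Omega y /\ dot z y = h.
Proof.
  unfold sphere_boundary; rewrite closure_cap_aux; split.
  - intros [[Hy Hzy] H]; split; [exact Hy|]. apply Rle_antisym; [|exact Hzy].
    cut (- h <= - dot z y); [lra|].
    apply (closure_continuous _ (fun u => - dot z u)) with (3 := H).
    + apply continuous_Ropp, continuous_dot.
    + intros u [Hu Hn]. apply Rnot_lt_le; intros L; apply Hn; split; [exact Hu|unfold h in L; lra].
  - intros [Hy Hzy]; repeat split; try assumption; [lra|].
    apply closure_incl; split; [exact Hy|intros [_ L]; unfold h in Hzy; lra].
Qed.

(** * The logarithmic radius and the mean value property *)

Let Y (s t : R) : R3 :=
  comb x v1 v2 (k * exp (- s) + c t + k * exp s * (1 - q * p)) (cos t - k * exp s * q * z1)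
    (sin t - k * exp s * q * z2).
Let Ys (s t : R) : R3 :=
  comb x v1 v2 (- (k * exp (- s)) + k * exp s * (1 - q * p)) (- (k * exp s * q * z1)) (- (k * exp s * q * z2)).
Let Yss (s t : R) : R3 :=
  comb x v1 v2 (k * exp (- s) + k * exp s * (1 - q * p)) (- (k * exp s * q * z1)) (- (k * exp s * q * z2)).
Let Yt (s t : R) : R3 := comb x v1 v2 (c' t) (- sin t) (cos t).
Let Ytt (s t : R) : R3 := comb x v1 v2 (- c t) (- cos t) (- sin t).

(** [Y] is the spatial part of the null vector itself; multiplied by [r = exp s] it becomes
    polynomial in [r] and extends to the center [r = 0]. Functions of degree 0 do not see the
    factor. *)
Lemma polar_V_exp (s t : R) : V (exp s) t = scal (exp s) (Y s t).
Proof.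
  apply coord_ext; intros a; rewrite coord_scal; unfold V, Y; rewrite !coord_comb.
  assert (E : exp s * exp (- s) = 1) by (rewrite <- exp_plus, Rplus_opp_r; apply exp_0).
  transitivity ((exp s * exp (- s) * k + exp s * c t + k * exp s ^ 2 * (1 - q * p)) * coord a x +
    (exp s * cos t - k * exp s ^ 2 * q * z1) * coord a v1 + (exp s * sin t - k * exp s ^ 2 * q * z2) * coord a v2);
    [rewrite E|]; ring.
Qed.

Lemma polar_Y_interior (s t : R) : s < 0 -> cone (cap rho z) (Y s t).
Proof.
  intros Hs.
  assert (E : Y s t = scal (exp (- s)) (V (exp s) t)).
  { rewrite polar_V_exp; apply coord_ext; intros a; rewrite !coord_scal, <- Rmult_assoc, <- exp_plus, Rplus_opp_l, exp_0; ring. }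
  rewrite E; apply (positive_cone_cap rho z); [apply exp_pos|apply polar_interior].
  generalize (exp_pos s) (exp_increasing _ _ Hs); rewrite exp_0; lra.
Qed.

(** Write [Z] for the rotating part. The Minkowski vectors with spatial parts [Ys], [Yt], [Z]
    (spacelike) and [Y - Z] (timelike) form a Lorentz orthonormal frame, and the claim is the
    spatial block of its completeness relation [delta = Ys Ys + Yt Yt + Z Z - (Y - Z) (Y - Z)]. *)
Lemma polar_conformal (s t : R) (a b : axis) :
  coord a (Ys s t) * coord b (Ys s t) + coord a (Yt s t) * coord b (Yt s t)
  = delta a b + coord a (Y s t) * coord b (Y s t)
    - coord a (Y s t) * coord b (comb x v1 v2 (c t) (cos t) (sin t))
    - coord a (comb x v1 v2 (c t) (cos t) (sin t)) * coord b (Y s t).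
Proof.
  rewrite <- (frame_delta _ _ _ Hfr). unfold Ys, Yt, Y; rewrite !coord_comb.
  assert (HD := polar_D_pos).
  set (al := k * exp (- s)). set (be := k * exp s).
  assert (Eab : al * be = k * k).
  { transitivity (k * k * (exp (- s) * exp s)); [unfold al, be; ring|].
    rewrite <- exp_plus, Rplus_opp_l, exp_0; ring. }
  assert (Eq : 2 * (al * be * q) = 1 / D) by (rewrite Eab, polar_kkq; field; lra).
  assert (Ek : 4 * (al * be) = rho * (2 - rho) / (D * D)) by (rewrite Eab; apply polar_4kk).
  assert (SC := sin2_cos2 t); unfold Rsqr in SC.
  set (u := 1 - q * p).
  (* Coefficients are compared in the frame: those involving [x] are settled here and in [E01],
     [E02]; the remaining ones reduce to [sin^2 + cos^2 = 1]. *)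
  assert (E00 : (- al + be * u) * (- al + be * u) + c' t * c' t
     - (1 + (al + c t + be * u) * (al + c t + be * u) - 2 * (al + c t + be * u) * c t) = 0).
  { transitivity (- (4 * (al * be)) + 2 * (2 * (al * be * q)) * p + (c t * c t + c' t * c' t) - 1); [unfold u; ring|].
    rewrite Ek, Eq, polar_cc.
    replace (rho * (2 - rho)) with (1 - h * h) by (unfold h; ring).
    replace p with (D + h) by (unfold D; ring). field; lra. }
  assert (E01 : (- al + be * u) * - (be * q * z1) + c' t * - sin t
     - ((al + c t + be * u) * (cos t - be * q * z1) - (al + c t + be * u) * cos t - c t * (cos t - be * q * z1)) = 0).
  { transitivity (2 * (al * be * q) * z1 + (c t * cos t - c' t * sin t)); [ring|].
    rewrite Eq. unfold c, c'.
    replace (1 / D * z1) with (z1 * (sin t * sin t + cos t * cos t) / D) by (rewrite SC; field; lra).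
    field; lra. }
  assert (E02 : (- al + be * u) * - (be * q * z2) + c' t * cos t
     - ((al + c t + be * u) * (sin t - be * q * z2) - (al + c t + be * u) * sin t - c t * (sin t - be * q * z2)) = 0).
  { transitivity (2 * (al * be * q) * z2 + (c t * sin t + c' t * cos t)); [ring|].
    rewrite Eq. unfold c, c'.
    replace (1 / D * z2) with (z2 * (sin t * sin t + cos t * cos t) / D) by (rewrite SC; field; lra).
    field; lra. }
  apply Rminus_diag_uniq.
  match type of E00 with ?e00 = 0 => match type of E01 with ?e01 = 0 => match type of E02 with ?e02 = 0 =>
    transitivity (e00 * (coord a x * coord b x) + e01 * (coord a x * coord b v1 + coord a v1 * coord b x)
      + e02 * (coord a x * coord b v2 + coord a v2 * coord b x)
      + (sin t * sin t + cos t * cos t - 1) * (coord a v1 * coord b v1 + coord a v2 * coord b v2));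
    [ring|rewrite E00, E01, E02, SC; ring] end end end.
Qed.

Lemma polar_is_derive (s t : R) (a : axis) :
  is_derive (fun s => coord a (Y s t)) s (coord a (Ys s t)) /\
  is_derive (fun s => coord a (Ys s t)) s (coord a (Yss s t)) /\
  is_derive (fun t => coord a (Y s t)) t (coord a (Yt s t)) /\
  is_derive (fun t => coord a (Yt s t)) t (coord a (Ytt s t)).
Proof.
  assert (HD := polar_D_pos).
  unfold Y, Ys, Yss, Yt, Ytt, c, c'; refine (conj _ (conj _ (conj _ _)));
    (eapply is_derive_ext; [intros r; symmetry; apply coord_comb|]); rewrite coord_comb;
    generalize (coord a x) (coord a v1) (coord a v2); intros; auto_derive; try lra; field; lra.
Qed.

Lemma cap_mean_value_aux (U : R3 -> R) :
  Ck_open 2 (cap rho z) U ->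
  continuous_on (cone (closure (cap rho z))) (radial_ext U) ->
  (forall y, cap rho z y -> beltrami U y = 0) ->
  is_RInt (fun t => U (unit_of (V 1 t))) 0 (2 * PI) (2 * PI * U x).
Proof.
  intros HU HC HL.
  destruct (positive_cone_cap rho z) as [HO HS].
  destruct (Ck2_partials _ _ HO HU) as (g & hh & Hg & Hh).
  assert (H0 : homogeneous (cone (cap rho z)) 0 (radial_ext U)).
  { apply radial_ext_homogeneous; intros y Hy; apply cone_cap in Hy; apply Hy. }
  assert (Hlap : forall y, cone (cap rho z) y -> sum3 (fun a => hh a a y) = 0).
  { intros y Hy. assert (P := proj1 (proj1 (cone_cap rho z y) Hy)).
    assert (Pi := Rinv_0_lt_compat _ P).
    assert (E := laplacian_homogeneous _ _ g hh (conj HO HS) H0 Hg Hh (/ enorm y) y Pi Hy).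
    cbv beta in E.
    rewrite <- (laplacian_partials _ (radial_ext U) g hh (scal (/ enorm y) y) HO Hg Hh (HS _ _ Pi Hy)) in E.
    assert (E0 := HL (unit_of y) (proj2 Hy)). unfold beltrami, unit_of in E0. rewrite E0 in E.
    apply (Rmult_eq_reg_r (/ (/ enorm y) ^ 2)); [rewrite Rmult_0_l; symmetry; exact E|].
    apply Rinv_neq_0_compat, pow_nonzero; lra. }
  (* Clamping the radius to [[0, 1]] keeps every point in the closed cap and makes [u] continuous on
     the whole plane, as [circle_mean_eq_center] demands. *)
  pose (clamp := fun r => (1 + Rabs r - Rabs (r - 1)) / 2).
  assert (Hclamp : forall r, 0 <= clamp r <= 1).
  { intros r; unfold clamp, Rabs; destruct (Rcase_abs r), (Rcase_abs (r - 1)); lra. }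
  assert (Iclamp : forall r, 0 <= r <= 1 -> clamp r = r).
  { intros r Hr; unfold clamp; rewrite Rabs_pos_eq, Rabs_left1 by lra; lra. }
  pose (u := fun r t => radial_ext U (V (clamp r) t)).
  assert (HV : forall r t, cone (closure (cap rho z)) (V (clamp r) t)).
  { intros r t. assert (P := polar_T_pos (clamp r) t). split.
    - apply enorm_pos; rewrite polar_enorm_V; exact P.
    - apply closure_cap_aux; split; [apply Omega_unit_of; rewrite polar_enorm_V; exact P|].
      rewrite dot_unit_of, polar_dot_z, polar_enorm_V.
      assert (HD := polar_D_pos). assert (Hk := polar_k_pos). assert (Hr := Hclamp r).
      apply (Rmult_le_reg_r (T (clamp r) t)); [exact P|].
      replace ((h * T (clamp r) t + D * k * (1 - clamp r ^ 2)) / T (clamp r) t * T (clamp r) t)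
        with (h * T (clamp r) t + D * k * (1 - clamp r ^ 2)) by (field; lra).
      assert (0 < D * k) by nra. assert (clamp r ^ 2 <= 1) by nra. nra. }
  assert (Hu : forall r t, continuity_2d_pt u r t).
  { intros r t; apply continuity_2d_pt_filterlim.
    apply (continuous_on_comp _ (radial_ext U) (fun w => V (clamp (fst w)) (snd w)) (r, t) HC).
    - intros; apply HV.
    - apply (continuous_polar (fun w => clamp (fst w)) snd); [|apply continuous_snd].
      apply (continuous_comp fst clamp); [apply continuous_fst|].
      unfold clamp, Rdiv; apply continuous_Rmult; [|apply continuous_const].
      apply continuous_Rminus; [apply continuous_Rplus; [apply continuous_const|]|].
      + apply continuous_Rabs.
      + apply (continuous_comp (fun r => r - 1) Rabs); [|apply continuous_Rabs].
        apply continuous_Rminus; [apply continuous_id|apply continuous_const]. }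
  pose (ws := fun s t => sum3 (fun a => g a (Y s t) * coord a (Ys s t))).
  pose (wt := fun s t => sum3 (fun a => g a (Y s t) * coord a (Yt s t))).
  pose (wss := fun s t => sum3 (fun a => sum3 (fun b => hh a b (Y s t) * coord b (Ys s t)) * coord a (Ys s t)
    + g a (Y s t) * coord a (Yss s t))).
  assert (uY : forall s t, s < 0 -> u (exp s) t = radial_ext U (Y s t)).
  { intros s t Hs. unfold u. rewrite Iclamp, polar_V_exp.
    - rewrite H0; [simpl; field|apply exp_pos|apply polar_Y_interior, Hs].
    - generalize (exp_pos s) (exp_increasing _ _ Hs); rewrite exp_0; lra. }
  assert (CY : forall y a, continuous (fun w : R * R => coord a (Y (fst w) (snd w))) y /\
     continuous (fun w : R * R => coord a (Ys (fst w) (snd w))) y /\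
     continuous (fun w : R * R => coord a (Yss (fst w) (snd w))) y).
  { intros y a; unfold Y, Ys, Yss, c, Rdiv; refine (conj _ (conj _ _));
      (eapply continuous_ext; [intros w'; symmetry; apply coord_comb|]); continuity_R. }
  assert (CY' : forall (f : R3 -> R) s t, continuous f (Y s t) ->
     continuous (fun w : R * R => f (Y (fst w) (snd w))) (s, t)).
  { intros f s t Hf; apply (continuous_comp (fun w : R * R => Y (fst w) (snd w)) f); [|exact Hf].
    apply continuous_of_coord; intros a; exact (proj1 (CY (s, t) a)). }
  assert (E : RInt (u 1) 0 (2 * PI) = RInt (u 0) 0 (2 * PI)).
  { apply (circle_mean_eq_center u ws wss wt Hu).
    - intros s t Hs.
      assert (HY := polar_Y_interior s t Hs).
      split; [|split; [|split; [|split; [|split]]]].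
      + apply is_derive_ext_loc with (fun s => radial_ext U (Y s t)).
        { generalize (open_lt 0 s Hs); apply filter_imp; intros r Hr; symmetry; apply uY, Hr. }
        apply (chain_rule_on (cone (cap rho z)) (radial_ext U) g (fun s => Y s t)); auto.
        intros a; apply polar_is_derive.
      + apply (second_derivative_along_curve (cone (cap rho z)) (radial_ext U) g hh (fun s => Y s t)
          (fun a s => coord a (Ys s t)) (fun a => coord a (Yss s t))); auto; intros a; apply polar_is_derive.
      + apply is_derive_ext with (fun t => radial_ext U (Y s t)).
        { intros r; symmetry; apply uY, Hs. }
        apply (chain_rule_on (cone (cap rho z)) (radial_ext U) g (Y s)); auto.
        intros a; apply polar_is_derive.
      + apply is_derive_eq with (sum3 (fun a => sum3 (fun b => hh a b (Y s t) * coord b (Yt s t)) * coord a (Yt s t)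
          + g a (Y s t) * coord a (Ytt s t))).
        * apply (second_derivative_along_curve (cone (cap rho z)) (radial_ext U) g hh (Y s)
            (fun a t => coord a (Yt s t)) (fun a => coord a (Ytt s t))); auto; intros a; apply polar_is_derive.
        * apply Rminus_diag_uniq; unfold wss. rewrite Rminus_def, Ropp_involutive, Rplus_comm.
          apply (conformal_pullback_harmonic (cone (cap rho z)) (radial_ext U) g hh (Y s t)
            (fun a => coord a (Ys s t)) (fun a => coord a (Yt s t)) (fun a => coord a (Yss s t))
            (fun a => coord a (Ytt s t)) (fun a => coord a (comb x v1 v2 (c t) (cos t) (sin t))));
            try assumption; [split; assumption|apply Hlap, HY| |].
          -- intros a b; apply polar_conformal.
          -- intros a; unfold Yss, Ytt, Y; rewrite !coord_comb; ring.
      + apply (continuity_2d_of_continuous ws); unfold ws.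
        exact (continuous_sum3_mult (fun a w => g a (Y (fst w) (snd w))) (fun a w => coord a (Ys (fst w) (snd w))) (s, t)
          (fun a => CY' (g a) s t (proj2 Hg a _ HY)) (fun a => proj1 (proj2 (CY (s, t) a)))).
      + apply (continuity_2d_of_continuous wss); unfold wss.
        exact (continuous_second_variation (fun a b w => hh a b (Y (fst w) (snd w)))
          (fun a w => g a (Y (fst w) (snd w))) (fun a w => coord a (Ys (fst w) (snd w)))
          (fun a w => coord a (Yss (fst w) (snd w))) (s, t)
          (fun a b => CY' (hh a b) s t (proj2 (Hh a) b _ HY)) (fun a => CY' (g a) s t (proj2 Hg a _ HY))
          (fun a => proj1 (proj2 (CY (s, t) a))) (fun a => proj2 (proj2 (CY (s, t) a)))).
    - intros s _; unfold wt, Y, Yt, c, c'. rewrite cos_2PI, sin_2PI, cos_0, sin_0; reflexivity. }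
  (* At [r = 0] all that is left of [V] is [k x], so the integrand is constant. *)
  assert (E0 : RInt (u 0) 0 (2 * PI) = 2 * PI * U x).
  { rewrite (RInt_ext (V := R_CompleteNormedModule) (u 0) (fun _ => U x)).
    - rewrite RInt_const. unfold scal; simpl; unfold mult; simpl; ring.
    - intros t _; unfold u, radial_ext. rewrite Iclamp by lra. f_equal.
      assert (EV : V 0 t = scal k x).
      { apply coord_ext; intros a; rewrite coord_scal; unfold V; rewrite coord_comb; ring. }
      rewrite EV, unit_of_scal, unit_of_Omega; [reflexivity|apply Hx|apply polar_k_pos|].
      rewrite (proj1 Hx); lra. }
  rewrite <- E0, <- E.
  apply is_RInt_ext with (u 1).
  - intros t _; unfold u, radial_ext; rewrite Iclamp by lra; reflexivity.
  - apply (RInt_correct (V := R_CompleteNormedModule)), (ex_RInt_continuous (V := R_CompleteNormedModule)).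
    intros t _; apply continuous_of_2d, Hu.
Qed.

(** The rotating vector has unit speed, and dividing a null vector by [T] divides the speed by [T],
    so the arc length element is [dt / T]. As [1 - x.eta = D / (w T)], kernel and arc length combine
    to the constant [w / D]. *)
Lemma cap_line_integral_aux (F : R3 -> R) (J : R) :
  is_RInt (fun t => F (unit_of (V 1 t))) 0 (2 * PI) J ->
  is_line_integral (sphere_boundary (cap rho z)) (fun y => 1 / (1 - dot x y) * F y) (w / D * J).
Proof.
  intros HJ.
  assert (HD := polar_D_pos). assert (Hw := polar_w_pos). assert (HT := polar_T_pos 1).
  pose (y0 := fun t => k + c t + k * (1 - q * p)).
  pose (y1 := fun t => cos t - k * q * z1).
  pose (y2 := fun t => sin t - k * q * z2).
  pose (tau := fun t => k + c t + k * (1 - q * h)).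
  assert (EV : forall t, V 1 t = comb x v1 v2 (y0 t) (y1 t) (y2 t)) by (intros t; unfold V, y0, y1, y2; f_equal; ring).
  assert (ET : forall t, T 1 t = tau t) by (intros t; unfold T, tau; ring).
  assert (Htau : forall t, 0 < tau t) by (intros t; rewrite <- ET; apply HT).
  pose (vel := fun f f' t => (f' * tau t - f * c' t) / (tau t * tau t)).
  pose (gam' := fun t => comb x v1 v2 (vel (y0 t) (c' t) t) (vel (y1 t) (- sin t) t) (vel (y2 t) (cos t) t)).
  assert (Egam : forall a t, coord a (unit_of (V 1 t)) = (y0 t * coord a x + y1 t * coord a v1 + y2 t * coord a v2) / tau t).
  { intros a t; unfold unit_of; rewrite coord_scal, polar_enorm_V, ET, EV, coord_comb; unfold Rdiv; ring. }
  assert (Ndot : forall t, y0 t * y0 t + y1 t * y1 t + y2 t * y2 t = tau t * tau t).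
  { intros t; rewrite <- ET, <- polar_V_sqr, EV; symmetry; apply dot_comb, Hfr. }
  (* Half the [t]-derivative of [Ndot]; it evaluates the cross term in the squared speed. *)
  assert (Nvel : forall t, c' t * y0 t - sin t * y1 t + cos t * y2 t = c' t * tau t).
  { intros t; transitivity (c' t * (k + c t + k * (1 - q * p)) + k * q * (z1 * sin t - z2 * cos t));
      [unfold y0, y1, y2; ring|].
    replace (z1 * sin t - z2 * cos t) with (D * c' t) by (unfold c'; field; lra).
    unfold tau, D; ring. }
  assert (Ngam' : forall t, enorm (gam' t) = / tau t).
  { intros t; specialize (Htau t). apply enorm_eq; [left; apply Rinv_0_lt_compat, Htau|].
    unfold gam', vel; rewrite dot_comb by exact Hfr.
    assert (SC := sin2_cos2 t); unfold Rsqr in SC.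
    transitivity (((c' t * c' t + (sin t * sin t + cos t * cos t)) * (tau t * tau t)
      - 2 * tau t * c' t * (c' t * y0 t - sin t * y1 t + cos t * y2 t)
      + c' t * c' t * (y0 t * y0 t + y1 t * y1 t + y2 t * y2 t)) / (tau t * tau t * (tau t * tau t))).
    - field; lra.
    - rewrite Ndot, Nvel, SC; field; lra. }
  exists 0, (2 * PI), (fun t => unit_of (V 1 t)), gam'.
  refine (conj _ (conj _ (conj _ (conj _ (conj _ _))))).
  - generalize PI_RGT_0; lra.
  - intros t _; refine (conj _ (conj _ _)).
    + apply is_derive_of_coord; intros a.
      eapply is_derive_ext; [intros s; symmetry; apply Egam|].
      unfold gam'; rewrite coord_comb; unfold vel.
      generalize (Htau t). unfold y0, y1, y2, tau, c, c', Rdiv.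
      generalize (coord a x) (coord a v1) (coord a v2) (/ D); intros r r1 r2 i P.
      auto_derive; [repeat split; lra|]. field; lra.
    + apply continuous_of_coord; intros a.
      eapply continuous_ext; [intros s; symmetry; apply coord_comb|].
      generalize (Htau t). unfold vel, y0, y1, y2, tau, c, c', Rdiv; intros P.
      continuity_R; apply Rgt_not_eq, Rmult_lt_0_compat; exact P.
    + apply enorm_pos; rewrite Ngam'; apply Rinv_0_lt_compat, Htau.
  - f_equal; rewrite !EV; unfold y0, y1, y2, c; rewrite cos_2PI, sin_2PI, cos_0, sin_0; reflexivity.
  - intros s t; apply polar_circle_unique.
  - intros y; rewrite sphere_boundary_cap_aux; split.
    + intros [Hy Hzy]; apply polar_circle_exists; assumption.
    + intros (t & _ & <-); apply polar_circle_boundary.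
  - apply is_RInt_ext with (fun t => scal (w / D) (F (unit_of (V 1 t)))).
    + intros t _; rewrite Ngam', dot_unit_of, polar_dot_x, polar_enorm_V, ET.
      specialize (Htau t).
      change (w / D * F (unit_of (V 1 t)) = 1 / (1 - (tau t - D / w * 1 ^ 2) / tau t) * F (unit_of (V 1 t)) * / tau t).
      field.
      repeat split; lra.
    + apply (is_RInt_scal (V := R_NormedModule)), HJ.
Qed.

(** The last clause is attached to the existential [I] because [is_line_integral] is a relation; it
    makes [U x] vanish for zero boundary values, which is the form used for uniqueness. *)
Lemma cap_poisson_aux (F U : R3 -> R) :
  Ck_open 2 (cap rho z) U ->
  continuous_on (cone (closure (cap rho z))) (radial_ext U) ->
  (forall y, cap rho z y -> beltrami U y = 0) ->
  (forall y, sphere_boundary (cap rho z) y -> U y = F y) ->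
  exists I : R,
    is_line_integral (sphere_boundary (cap rho z)) (fun y => 1 / (1 - dot x y) * F y) I /\
    U x = 1 / (2 * PI) * ((dot x z + rho - 1) / sqrt (rho * (2 - rho))) * I /\
    ((forall y, sphere_boundary (cap rho z) y -> F y = 0) -> I = 0).
Proof.
  intros HU HC HL HF.
  assert (HJ := cap_mean_value_aux U HU HC HL).
  assert (HJ' : is_RInt (fun t => F (unit_of (V 1 t))) 0 (2 * PI) (2 * PI * U x)).
  { apply is_RInt_ext with (2 := HJ); intros t _.
    apply HF, sphere_boundary_cap_aux, polar_circle_boundary. }
  assert (HD := polar_D_pos). assert (Hw := polar_w_pos). assert (HP := PI_RGT_0).
  exists (w / D * (2 * PI * U x)); refine (conj _ (conj _ _)).
  - apply cap_line_integral_aux, HJ'.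
  - fold p w. replace (p + rho - 1) with D by (unfold D, h; ring). field; lra.
  - intros H0.
    assert (E : 2 * PI * U x = 0).
    { rewrite <- (is_RInt_unique (V := R_CompleteNormedModule) _ _ _ _ HJ').
      rewrite (RInt_ext (V := R_CompleteNormedModule) _ (fun _ => 0)).
      - rewrite RInt_const. unfold scal; simpl; unfold mult; simpl; ring.
      - intros t _; apply H0, sphere_boundary_cap_aux, polar_circle_boundary. }
    rewrite E; ring.
Qed.

End Polar.

(** Polar coordinates centered at [z] itself remove the auxiliary point and frame from the
    description. *)
Lemma closure_cap (rho : R) (z y : R3) : 0 < rho < 2 -> Omega z ->
  closure (cap rho z) y <-> Omega y /\ 1 - rho <= dot z y.
Proof.
  intros Hr Hz. assert (Ez := proj1 (Omega_dot z) Hz).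
  destruct (frame_exists z Ez) as (v1 & v2 & Hf).
  apply (closure_cap_aux rho z z v1 v2); try assumption. split; [exact Hz|lra].
Qed.

Lemma sphere_boundary_cap (rho : R) (z y : R3) : 0 < rho < 2 -> Omega z ->
  sphere_boundary (cap rho z) y <-> Omega y /\ dot z y = 1 - rho.
Proof.
  intros Hr Hz. assert (Ez := proj1 (Omega_dot z) Hz).
  destruct (frame_exists z Ez) as (v1 & v2 & Hf).
  apply (sphere_boundary_cap_aux rho z z v1 v2); try assumption. split; [exact Hz|lra].
Qed.

Lemma cap_poisson (rho : R) (z x : R3) (F U : R3 -> R) : 0 < rho < 2 -> Omega z -> cap rho z x ->
  Ck_open 2 (cap rho z) U ->
  continuous_on (cone (closure (cap rho z))) (radial_ext U) ->
  (forall y, cap rho z y -> beltrami U y = 0) ->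
  (forall y, sphere_boundary (cap rho z) y -> U y = F y) ->
  exists I : R,
    is_line_integral (sphere_boundary (cap rho z)) (fun y => 1 / (1 - dot x y) * F y) I /\
    U x = 1 / (2 * PI) * ((dot x z + rho - 1) / sqrt (rho * (2 - rho))) * I /\
    ((forall y, sphere_boundary (cap rho z) y -> F y = 0) -> I = 0).
Proof.
  intros Hr Hz Hx. destruct (frame_exists x (proj1 (Omega_dot x) (proj1 Hx))) as (v1 & v2 & Hf).
  apply (cap_poisson_aux rho z x v1 v2); assumption.
Qed.

(** * Logarithmic potentials *)

(** [(A, Q)] stands for a null vector: [(1, xi)] gives the fundamental solution with pole [xi], and
    [(r_check, r_check xi_check)] gives the regular part of the Green function. *)
Definition log_potential (A : R) (Q y : R3) : R :=
  / (4 * PI) * ln (A - dot Q y) + / (4 * PI) * (1 - ln 2).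

Section LogPotential.

Variables (A : R) (Q : R3).
Hypothesis (HQ : dot Q Q = A * A).

Let kappa := / (4 * PI).
(** [L] is [A - dot Q y] made homogeneous of degree 1, so on [W] the radial extension is
    [kappa (ln L - ln |x|)] up to a constant; [g] and [h] are its first and second partial
    derivatives. *)
Let L x := A * enorm x - dot Q x.
Let W x := 0 < enorm x /\ 0 < L x.
Let g a x := kappa * ((A * coord a x / enorm x - coord a Q) / L x - coord a x / (enorm x * enorm x)).
Let h a b x := kappa * (A * (delta a b / enorm x - coord a x * coord b x / (enorm x * enorm x * enorm x)) / L x
  - (A * coord a x / enorm x - coord a Q) * (A * coord b x / enorm x - coord b Q) / (L x * L x)
  - delta a b / (enorm x * enorm x)
  + 2 * coord a x * coord b x / (enorm x * enorm x * (enorm x * enorm x))).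

Lemma is_derive_enorm_upd (a : axis) (x : R3) : 0 < enorm x ->
  is_derive (fun t => enorm (upd a x t)) (coord a x) (coord a x / enorm x).
Proof.
  intros Hx; unfold enorm in *.
  apply is_derive_eq with (2 * coord a x / (2 * sqrt (dot x x))).
  - replace (dot x x) with (dot (upd a x (coord a x)) (upd a x (coord a x))) at 1 by (rewrite upd_coord; reflexivity).
    apply (is_derive_sqrt (fun t => dot (upd a x t) (upd a x t))).
    + destruct x as [[? ?] ?], a; unfold dot; simpl; auto_derive; try exact I; ring.
    + rewrite upd_coord. apply sqrt_lt_0_alt. rewrite sqrt_0; exact Hx.
  - field; lra.
Qed.

Lemma is_derive_dot_upd (a : axis) (x : R3) :
  is_derive (fun t => dot Q (upd a x t)) (coord a x) (coord a Q).
Proof. destruct x as [[? ?] ?], a; unfold dot; simpl; auto_derive; try exact I; ring. Qed.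

Lemma radial_ext_log_potential (x : R3) :
  radial_ext (log_potential A Q) x = kappa * ln (A - dot Q x / enorm x) + kappa * (1 - ln 2).
Proof. unfold radial_ext, log_potential; rewrite dot_unit_of; reflexivity. Qed.

Lemma delta_sym (a b : axis) : delta a b = delta b a.
Proof. destruct a, b; reflexivity. Qed.

(** Norm and inner product along a coordinate line enter as arbitrary differentiable functions,
    which [auto_derive] treats as atoms. *)
Lemma is_derive_log_quotient (n s : R -> R) (t dn ds : R) :
  is_derive n t dn -> is_derive s t ds -> 0 < n t -> 0 < A - s t / n t ->
  is_derive (fun u => kappa * ln (A - s u / n u) + kappa * (1 - ln 2)) t
    (kappa * (- ((ds * n t - s t * dn) / (n t * n t)) / (A - s t / n t))).
Proof.
  intros Hn Hs Pn PA. auto_derive.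
  - repeat split; [exists ds; exact Hs|exists dn; exact Hn|lra|exact PA].
  - rewrite (is_derive_unique (fun u : R => n u) t dn Hn), (is_derive_unique (fun u : R => s u) t ds Hs). unfold kappa; field.
    assert (A * n t - s t = (A - s t / n t) * n t) by (field; lra).
    assert (K := PI_RGT_0). repeat split; try lra; apply Rgt_not_eq; nra.
Qed.

Lemma is_derive_log_gradient (n s c : R -> R) (t dn ds dc Qa : R) :
  is_derive n t dn -> is_derive s t ds -> is_derive c t dc -> 0 < n t -> 0 < A * n t - s t ->
  is_derive (fun u => kappa * ((A * c u / n u - Qa) / (A * n u - s u) - c u / (n u * n u))) t
    (kappa * (A * (dc / n t - c t * dn / (n t * n t)) / (A * n t - s t)
      - (A * c t / n t - Qa) * (A * dn - ds) / ((A * n t - s t) * (A * n t - s t))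
      - dc / (n t * n t) + 2 * c t * dn / (n t * n t * n t))).
Proof.
  intros Hn Hs Hc Pn PA. auto_derive.
  - repeat split; try (eexists; eassumption); try lra; apply Rgt_not_eq; nra.
  - rewrite (is_derive_unique (fun u : R => n u) t dn Hn), (is_derive_unique (fun u : R => s u) t ds Hs), (is_derive_unique (fun u : R => c u) t dc Hc).
    unfold kappa; field. assert (K := PI_RGT_0). repeat split; lra.
Qed.

Lemma log_potential_partial (a : axis) (x : R3) : W x ->
  is_derive (fun t => radial_ext (log_potential A Q) (upd a x t)) (coord a x) (g a x).
Proof.
  intros [HN HL].
  apply is_derive_ext with (fun t => kappa * ln (A - dot Q (upd a x t) / enorm (upd a x t)) + kappa * (1 - ln 2)).
  { intros t; symmetry; apply radial_ext_log_potential. }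
  assert (EL : A - dot Q x / enorm x = L x / enorm x) by (unfold L; field; lra).
  assert (P : 0 < A - dot Q x / enorm x) by (rewrite EL; apply Rdiv_lt_0_compat; assumption).
  eapply is_derive_eq.
  - apply (is_derive_log_quotient (fun t => enorm (upd a x t)) (fun t => dot Q (upd a x t)));
      [apply is_derive_enorm_upd, HN|apply is_derive_dot_upd| |]; rewrite upd_coord; assumption.
  - rewrite upd_coord, EL; unfold g, L in *; field; lra.
Qed.

Lemma log_potential_partial2 (a b : axis) (x : R3) : W x ->
  is_derive (fun t => g a (upd b x t)) (coord b x) (h a b x).
Proof.
  intros [HN HL]. unfold g, L.
  eapply is_derive_eq.
  - apply (is_derive_log_gradient (fun t => enorm (upd b x t)) (fun t => dot Q (upd b x t)) (fun t => coord a (upd b x t)));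
      [apply is_derive_enorm_upd, HN|apply is_derive_dot_upd|apply is_derive_coord_upd| |]; rewrite upd_coord; assumption.
  - rewrite upd_coord, (delta_sym b a); unfold h, L in *; field; lra.
Qed.

Lemma continuous_log_potential (x : R3) : W x ->
  continuous (radial_ext (log_potential A Q)) x /\ (forall a, continuous (g a) x) /\
  forall a b, continuous (h a b) x.
Proof.
  intros [HN HL].
  assert (CL : continuous L x).
  { unfold L; apply continuous_Rminus; [|apply continuous_dot].
    apply continuous_Rmult; [apply continuous_const|apply continuous_enorm]. }
  assert (CN := continuous_enorm x).
  assert (PN : 0 < enorm x * enorm x) by nra.
  assert (EL : A - dot Q x * / enorm x = L x / enorm x) by (unfold L; field; lra).
  refine (conj _ (conj _ _)).
  - eapply continuous_ext; [intros y; symmetry; apply radial_ext_log_potential|].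
    unfold Rdiv; continuity_R; try assumption; try lra; [|apply continuous_dot].
    rewrite EL; apply Rdiv_lt_0_compat; assumption.
  - intros a; unfold g, Rdiv; continuity_R; try assumption; lra.
  - intros a b; unfold h, Rdiv; continuity_R; try assumption; try lra; apply Rgt_not_eq; nra.
Qed.

Lemma Ck_log_potential (D E : R3 -> Prop) :
  (forall x, D x -> W x) -> (forall x, E x -> W x) -> Ck 2 D E (radial_ext (log_potential A Q)).
Proof.
  intros HD HE.
  assert (C : forall f : R3 -> R, (forall x, W x -> continuous f x) -> continuous_on E f).
  { intros f Hf x Hx; eapply filterlim_filter_le_1; [apply filter_le_within|apply Hf, HE, Hx]. }
  split; [apply C; intros x Hx; exact (proj1 (continuous_log_potential x Hx))|].
  intros a; exists (g a); split; [intros x Hx; apply log_potential_partial, HD, Hx|].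
  split; [apply C; intros x Hx; exact (proj1 (proj2 (continuous_log_potential x Hx)) a)|].
  intros b; exists (h a b); split; [intros x Hx; apply log_potential_partial2, HD, Hx|].
  split; [apply C; intros x Hx; exact (proj2 (proj2 (continuous_log_potential x Hx)) a b)|exact I].
Qed.

(** By [dot Q Q = A * A] the contributions of [ln L] cancel; what remains is the Laplacian of
    [- ln |x|], which equals [-1] at unit vectors. *)
Lemma beltrami_log_potential (D : R3 -> Prop) (x : R3) :
  open D -> (forall x, D x -> W x) -> D x -> Omega x ->
  beltrami (log_potential A Q) x = - / (4 * PI).
Proof.
  intros HD HW Hx Hxx.
  assert (K := PI_RGT_0).
  unfold beltrami; rewrite (laplacian_partials D _ g h x HD); try assumption.
  - destruct (HW x Hx) as [_ HL]. apply Omega_dot in Hxx as Hdx.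
    assert (HLQ : dot Q x = A - L x) by (unfold L; rewrite Hxx; ring).
    transitivity (kappa * (A * (3 - dot x x) / L x
      - (A * A * dot x x - 2 * A * dot Q x + dot Q Q) / (L x * L x) - 3 + 2 * dot x x)).
    + unfold h, sum3; rewrite Hxx; cbv [delta]; unfold dot; field; lra.
    + rewrite Hdx, HQ, HLQ; unfold kappa; field; lra.
  - split; intros a y Hy; [apply log_potential_partial, HW, Hy|].
    exact (proj1 (proj2 (continuous_log_potential y (HW y Hy))) a).
  - intros a; split; intros b y Hy; [apply log_potential_partial2, HW, Hy|].
    exact (proj2 (proj2 (continuous_log_potential y (HW y Hy))) a b).
Qed.

End LogPotential.

(** * The Green function of a cap *)

Section CapGreen.

Variables (rho : R) (z x : R3).
Hypotheses (Hrho : 0 < rho < 2) (Hz : Omega z) (Hx : cap rho z x).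

Let quot := r_check_quot rho z x.
Let Rc := r_check rho z x.
Let Q := scal Rc (xi_check rho z x).

(** The quotient is the reflection coefficient [q]; both branches of its definition give this
    formula, so the case distinction at [rho = 1] ends here. *)
Lemma r_check_quot_eq : quot = 2 * (dot x z + rho - 1) / (rho * (2 - rho)).
Proof.
  unfold quot, r_check_quot; destruct (Req_EM_T rho 1) as [->|Hn]; [field|].
  unfold r_check; field; lra.
Qed.

Lemma r_check_eq : Rc = 1 + quot * (rho - 1).
Proof. rewrite r_check_quot_eq; unfold Rc, r_check; field; lra. Qed.

Lemma r_check_quot_pos : 0 < quot.
Proof.
  rewrite r_check_quot_eq; destruct Hx as [_ H]; rewrite dot_comm in H.
  apply Rdiv_lt_0_compat; nra.
Qed.

Lemma r_check_pos : 0 < Rc.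
Proof.
  assert (H := proj1 (cauchy_schwarz x z (proj1 Hx) Hz)).
  destruct Hx as [_ H']; rewrite dot_comm in H'.
  unfold Rc, r_check.
  replace (- ((1 + 2 * dot x z * (rho - 1) + (rho - 1) ^ 2) / (rho * (rho - 2))))
    with ((1 + 2 * dot x z * (rho - 1) + (rho - 1) ^ 2) / (rho * (2 - rho))) by (field; lra).
  apply Rdiv_lt_0_compat; [|nra].
  (* For [rho >= 1] the numerator is at least [1 - (rho - 1)^2], by [x.z > 1 - rho]; for [rho < 1]
     it is at least [rho^2], by [x.z <= 1]. *)
  destruct (Rle_dec 1 rho); nra.
Qed.

Lemma coord_scaled_xi_check (a : axis) : coord a Q = coord a x - quot * coord a z.
Proof.
  assert (P := r_check_pos). fold Rc in P.
  unfold Q, xi_check; rewrite coord_scal; fold Rc quot.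
  transitivity (Rc * (coord a (scal (/ Rc) x) - coord a (scal (quot / Rc) z))).
  - f_equal; destruct x as [[? ?] ?], z as [[? ?] ?], a; reflexivity.
  - rewrite !coord_scal; field; lra.
Qed.

Lemma dot_scaled_xi_check (y : R3) : dot Q y = dot x y - quot * dot z y.
Proof. unfold dot; rewrite !coord_scaled_xi_check; ring. Qed.

Lemma dot_scaled_xi_check_self : dot Q Q = Rc * Rc.
Proof.
  assert (Ex := proj1 (Omega_dot x) (proj1 Hx)). assert (Ez := proj1 (Omega_dot z) Hz).
  rewrite dot_scaled_xi_check, !(dot_comm _ Q), !dot_scaled_xi_check, (dot_comm z x), Ex, Ez, r_check_eq.
  assert (E : quot * (rho * (2 - rho)) = 2 * (dot x z + rho - 1)) by (rewrite r_check_quot_eq; field; lra).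
  assert (E' : dot x z = quot * (rho * (2 - rho)) / 2 + 1 - rho) by lra.
  rewrite E'; field.
Qed.

Lemma log_argument (y : R3) : Rc - dot Q y = 1 - dot x y + quot * (dot z y - (1 - rho)).
Proof. rewrite dot_scaled_xi_check, r_check_eq; ring. Qed.

(** On the closed cap both summands in [log_argument] are nonnegative; the first vanishes only at
    [y = x], where the second is positive because [x] lies in the open cap. *)
Lemma log_argument_pos (y : R3) : Omega y -> 1 - rho <= dot z y -> 0 < Rc - dot Q y.
Proof.
  intros Hy Hzy; rewrite log_argument.
  assert (P := r_check_quot_pos).
  destruct (cauchy_schwarz x y (proj1 Hx) Hy) as [[H|H] Heq]; [nra|].
  destruct Hx as [_ K]; rewrite (Heq H) in K at 1. rewrite H. nra.
Qed.

Lemma log_argument_cone (y : R3) : cone (closure (cap rho z)) y ->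
  0 < enorm y /\ 0 < Rc * enorm y - dot Q y.
Proof.
  intros [H0 Hc]; apply enorm_pos in H0; apply closure_cap in Hc; try assumption.
  split; [exact H0|].
  assert (K := log_argument_pos _ (proj1 Hc) (proj2 Hc)). rewrite dot_unit_of in K.
  replace (Rc * enorm y - dot Q y) with (enorm y * (Rc - dot Q y / enorm y)) by (field; lra). nra.
Qed.

Lemma cone_cap_closure (y : R3) : cone (cap rho z) y -> cone (closure (cap rho z)) y.
Proof. intros [H0 H]; split; [exact H0|apply closure_incl, H]. Qed.

Lemma cap_green_split (y : R3) :
  cap_green rho z x y = G_beltrami (dot x y) - log_potential Rc Q y.
Proof.
  unfold cap_green, G_beltrami, log_potential, Q.
  rewrite (dot_comm (scal _ _)), dot_scal_r, (dot_comm y).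
  fold Rc; replace (Rc * (1 - dot (xi_check rho z x) y)) with (Rc - Rc * dot (xi_check rho z x) y) by ring.
  ring.
Qed.

Lemma cap_log_potential_spec :
  Ck_open 2 (cap rho z) (log_potential Rc Q) /\
  Ck_closure 1 (cap rho z) (log_potential Rc Q) /\
  (forall y, cap rho z y -> beltrami (log_potential Rc Q) y = - / (4 * PI)) /\
  (forall y, sphere_boundary (cap rho z) y -> log_potential Rc Q y = G_beltrami (dot x y)).
Proof.
  assert (HQ := dot_scaled_xi_check_self).
  assert (HO : forall y, cone (cap rho z) y -> 0 < enorm y /\ 0 < Rc * enorm y - dot Q y).
  { intros y Hy; apply log_argument_cone, cone_cap_closure, Hy. }
  refine (conj _ (conj _ (conj _ _))).
  - apply (Ck_log_potential Rc Q); exact HO.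
  - destruct (Ck_log_potential Rc Q (cone (cap rho z)) (cone (closure (cap rho z))) HO log_argument_cone) as [C0 C1].
    split; [exact C0|]. intros a; destruct (C1 a) as [g [Dg [Cg _]]].
    exists g; split; [exact Dg|split; [exact Cg|exact I]].
  - intros y Hy; apply (beltrami_log_potential Rc Q HQ (cone (cap rho z))).
    + apply positive_cone_cap.
    + exact HO.
    + split; [apply enorm_pos; rewrite (proj1 Hy); lra|rewrite unit_of_Omega; [exact Hy|apply Hy]].
    + apply Hy.
  - intros y Hy; apply sphere_boundary_cap in Hy; try assumption; destruct Hy as [_ Hy].
    unfold log_potential, G_beltrami. rewrite log_argument, Hy. do 3 f_equal; ring.
Qed.

End CapGreen.

(** * Uniqueness and the theorem *)

Lemma Ck_open_of_closure (k : nat) (Gam : R3 -> Prop) (f : R3 -> R) :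
  Ck_closure k Gam f -> Ck_open k Gam f.
Proof.
  apply Ck_incl; intros y [H0 H]; split; [exact H0|apply closure_incl, H].
Qed.

Lemma Ck_continuous_on (k : nat) (D E : R3 -> Prop) (f : R3 -> R) : Ck k D E f -> continuous_on E f.
Proof. destruct k; intros [H _]; exact H. Qed.

(** The difference is harmonic with zero boundary values, so the Poisson formula gives 0 inside; on
    the circle the boundary condition itself applies. *)
Lemma cap_dirichlet_unique (rho : R) (z x : R3) (f g : R3 -> R) : 0 < rho < 2 -> Omega z ->
  Ck_open 2 (cap rho z) f -> Ck_open 2 (cap rho z) g ->
  Ck_closure 0 (cap rho z) f -> Ck_closure 0 (cap rho z) g ->
  (forall y, cap rho z y -> beltrami f y = beltrami g y) ->
  (forall y, sphere_boundary (cap rho z) y -> f y = g y) ->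
  closure (cap rho z) x -> f x = g x.
Proof.
  intros Hr Hz Hf Hg Cf Cg HL HB Hx.
  apply closure_cap in Hx as [Hxx [Hzx|Hzx]]; try assumption.
  - assert (Kx : cap rho z x) by (split; [exact Hxx|lra]).
    destruct (cap_poisson rho z x (fun _ => 0) (fun y => f y - g y) Hr Hz Kx) as (I & _ & E & H0).
    + exact (Ck_minus 2 _ _ _ _ Hf Hg).
    + apply (Ck_continuous_on 0 (cone (cap rho z))). exact (Ck_minus 0 _ _ _ _ Cf Cg).
    + intros y Hy. assert (K := HL y Hy). unfold beltrami in *.
      change (radial_ext (fun y => f y - g y)) with (fun y => radial_ext f y - radial_ext g y).
      rewrite (laplacian_minus (cone (cap rho z))); try assumption; [lra|apply positive_cone_cap|].
      split; [apply enorm_pos; rewrite (proj1 Hy); lra|rewrite unit_of_Omega; [exact Hy|apply Hy]].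
    + intros y Hy; rewrite (HB y Hy); ring.
    + rewrite H0 in E by reflexivity. rewrite Rmult_0_r in E. lra.
  - apply HB, sphere_boundary_cap; auto.
Qed.

Theorem theorem2p5 (zeta : R3) (rho : R) (hzeta : Omega zeta) (hrho : 0 < rho < 2) :
  is_the_dirichlet_green (cap rho zeta) (cap_green rho zeta) /\
  forall F U : R3 -> R,
    continuous_on (sphere_boundary (cap rho zeta)) F ->
    Ck_closure 2 (cap rho zeta) U ->
    (forall xi, cap rho zeta xi -> beltrami U xi = 0) ->
    (forall eta, sphere_boundary (cap rho zeta) eta -> U eta = F eta) ->
    forall xi, cap rho zeta xi ->
      exists I : R,
        is_line_integral (sphere_boundary (cap rho zeta))
          (fun eta => 1 / (1 - dot xi eta) * F eta) I /\
        U xi = 1 / (2 * PI)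
               * ((dot xi zeta + rho - 1) / sqrt (rho * (2 - rho))) * I.
Proof.
  pose (Phi := fun xi => log_potential (r_check rho zeta xi) (scal (r_check rho zeta xi) (xi_check rho zeta xi))).
  split; [split|].
  - exists Phi; split.
    + intros xi eta _ _ _; apply cap_green_split.
    + intros xi Hxi; apply cap_log_potential_spec; assumption.
  - intros GD' (Phi' & Heq & HPhi') xi eta Hxi Heta Hne.
    (* Both Green functions have the same singular part, so only the regular parts have to be
       compared. *)
    rewrite Heq, cap_green_split by assumption. f_equal.
    destruct (HPhi' xi Hxi) as (A1 & A2 & A3 & A4).
    destruct (cap_log_potential_spec rho zeta xi hrho hzeta Hxi) as (B1 & B2 & B3 & B4).
    apply (cap_dirichlet_unique rho zeta); try assumption.
    + exact (conj (Ck_continuous_on _ _ _ _ A2) I).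
    + exact (conj (Ck_continuous_on _ _ _ _ B2) I).
    + intros y Hy; rewrite A3, B3 by assumption; reflexivity.
    + intros y Hy; rewrite A4, B4 by assumption; reflexivity.
  - intros F U _ HU HL HB xi Hxi.
    destruct (cap_poisson rho zeta xi F U) as (I & HI & HE & _); try assumption.
    + apply Ck_open_of_closure, HU.
    + exact (Ck_continuous_on _ _ _ _ HU).
    + exists I; split; assumption.
Qed.
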